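(* Let $A$ be a $C^*$-algebra. Suppose there exists $n \in \mathbb{N}$ such that for every finite subset $\mathfrak{F} \subset A$ and every $\varepsilon>0$ there exist completely positive contractive maps $\psi:A \longrightarrow F$ and $\varphi: F \longrightarrow A$, where $F$ is a finite dimensional $C^*$-algebra and $\varphi$ is a convex combination of $n$ contractive order zero maps $F\longrightarrow A$, such that $$\|a - \varphi(\psi (a)) \| < \varepsilon$$ for all $a \in \mathfrak{F}$. Then $A$ is AF.
   Context: A completely positive map $\varphi:A \longrightarrow B$ between $C^*$-algebras has order zero if it preserves orthogonality, i.e. if $a,b \in A_{+}$ satisfy $ab=0$ then $\varphi(a)\varphi(b)=0$; order zero maps are by definition completely positive. A $C^*$-algebra $A$ (not assumed separable) is called AF if for every finite subset $\mathfrak{F} \subset A$ and $\varepsilon > 0$ there exists a finite dimensional $C^*$-algebra $B \subset A$ such that $\mathrm{dist}(a,B)=\inf_{b\in B}\|a-b\| < \varepsilon$ for all $a \in \mathfrak{F}$. The number $n$ is independent of $\mathfrak{F}$ and $\varepsilon$, while the coefficients of the convex combination (nonnegative reals summing to $1$) may depend on $\mathfrak{F}$ and $\varepsilon$. *)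

(* Defs.v *)
(* The field of complex numbers is [R[i]] for
   [R : realType]; norms on complex normed modules take values in [R[i]]. *)
From HB Require Import structures.
From mathcomp Require Import all_boot all_order all_algebra.
From mathcomp Require Import complex.
From mathcomp Require Import all_classical all_reals all_analysis.

Set Implicit Arguments.
Unset Strict Implicit.
Unset Printing Implicit Defensive.

Import Order.TTheory GRing.Theory Num.Theory.
Import numFieldNormedType.Exports.

Local Open Scope classical_set_scope.
Local Open Scope complex_scope.
Local Open Scope ring_scope.

(* No unit is assumed (and the zero algebra is allowed), so the product is not
   MathComp's ring product. *)
HB.mixin Record isCStarAlgebra (R : realType) A
    & CompleteNormedModule R[i] A := {
  smul : A -> A -> A ;
  star : A -> A ;
  smulA : associative smul ;
  smulDl : left_distributive smul +%R ;
  smulDr : right_distributive smul +%R ;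
  smulZl : forall (c : R[i]) (a b : A), smul (c *: a) b = c *: smul a b ;
  smulZr : forall (c : R[i]) (a b : A), smul a (c *: b) = c *: smul a b ;
  starK : involutive star ;
  starD : {morph star : a b / a + b} ;
  starZ : forall (c : R[i]) (a : A), star (c *: a) = conjc c *: star a ;
  starM : forall a b : A, star (smul a b) = smul (star b) (star a) ;
  norm_smul : forall a b : A, `|smul a b| <= `|a| * `|b| ;
  cstar_identity : forall a : A, `|smul (star a) a| = `|a| ^+ 2
}.

#[short(type="cstarAlgType")]
HB.structure Definition CStarAlgebra (R : realType) :=
  { A of isCStarAlgebra R A & CompleteNormedModule R[i] A }.

Notation "a ** b" := (smul a b) (at level 40, left associativity) : ring_scope.

Section CStarAlgebras.
Context {R : realType}.
Implicit Types A B : cstarAlgType R.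

Definition rnorm A (a : A) : R := complex.Re `|a|.

(* The elements b^* b are exactly the positive elements of a C*-algebra; the
   same description of M_n(A)_+ below avoids constructing the C*-norm of M_n(A). *)
Definition positive A (a : A) : Prop := exists b : A, a = star b ** b.

(* The *-algebra structure of M_n(A); MathComp's matrix product needs a
   unital ring of coefficients. *)
Definition mxsmul A n (X Y : 'M[A]_n) : 'M[A]_n :=
  \matrix_(i, j) \sum_k X i k ** Y k j.

Definition mxstar A n (X : 'M[A]_n) : 'M[A]_n := \matrix_(i, j) star (X j i).

Definition mxpositive A n (X : 'M[A]_n) : Prop :=
  exists Y : 'M[A]_n, X = mxsmul (mxstar Y) Y.

Definition completely_positive A B (f : {linear A -> B}) : Prop :=
  forall (n : nat) (X : 'M[A]_n), mxpositive X -> mxpositive (map_mx f X).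

Definition contractive A B (f : {linear A -> B}) : Prop :=
  forall a, `|f a| <= `|a|.

Definition order_zero A B (f : {linear A -> B}) : Prop :=
  completely_positive f /\
  forall a b : A, positive a -> positive b -> a ** b = 0 -> f a ** f b = 0.

Definition convex_combination A B n (f : {linear A -> B})
    (g : 'I_n -> {linear A -> B}) : Prop :=
  exists t : 'I_n -> R,
    [/\ forall i, 0 <= t i, \sum_i t i = 1 &
        forall a, f a = \sum_i (t i)%:C *: g i a].

Definition finite_dimensional A (V : set A) : Prop :=
  exists n (e : 'I_n -> A),
    V = range (fun c : 'I_n -> R[i] => \sum_i c i *: e i).

Record cstar_subalgebra A (B : set A) : Prop := CStarSubalgebra {
  csub0 : B 0 ;
  csubD : forall a b, B a -> B b -> B (a + b) ;
  csubZ : forall (c : R[i]) a, B a -> B (c *: a) ;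
  csubM : forall a b, B a -> B b -> B (a ** b) ;
  csub_star : forall a, B a -> B (star a) ;
  csub_closed : closed B
}.

Definition dist A (a : A) (B : set A) : R := inf [set rnorm (a - b) | b in B].

Definition AF A : Prop :=
  forall (S : set A) (eps : R), finite_set S -> 0 < eps ->
  exists B : set A,
    [/\ cstar_subalgebra B, finite_dimensional B &
        forall a, S a -> dist a B < eps].

End CStarAlgebras.

(* Main.v *)
(* Pick a component [g] of the convex combination with coefficient at least
   [1/n] and put [T = g \o psi]. By the Kadison-Schwarz inequality,
   [sum_j t_j (T_j a - a)^* (T_j a - a)] is dominated by
   [f(a^* a) - f(a)^* a - a^* f(a) + a^* a] with [f = phi \o psi], which is
   small, so [T] itself is close to the identity on any prescribed finite set:
   the order zero map [g] can replace [phi].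

   Let [e] be an approximate unit for the given elements, [p] the spectral
   projection of [psi e] for the values above [1/2], [h = g 1] and [k = g p].
   Order zero maps satisfy [g x ** g y = h ** g (x ** y)], [k] acts almost as
   a unit on the given elements, and [k] is almost a projection because [h] is
   almost a unit on [e]. If [G] solves [k ** G^2 = G] near [k], then
   [G ** g (p F p)] is a finite-dimensional C*-algebra, and it almost contains
   [a], because [a ~ k a k ~ k g (psi a) k = k^2 g (p (psi a) p)].

   The C*-algebraic background (square roots, [b^* b >= 0], approximate units)
   is obtained without spectra, from the iteration [s := (t + s^2) / 2] for
   [1 - sqrt (1 - t)] and from [|c| <= 1] for the imaginary part [c] of a
   unitary. *)
Require Import Defs.
From HB Require Import structures.
From mathcomp Require Import all_boot all_order all_algebra.
From mathcomp Require Import complex.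
From mathcomp Require Import all_classical all_reals all_analysis.
From mathcomp Require Import ring lra.

Set Implicit Arguments.
Unset Strict Implicit.
Unset Printing Implicit Defensive.

Import Order.TTheory GRing.Theory Num.Theory.
Import numFieldNormedType.Exports.

Local Open Scope classical_set_scope.
Local Open Scope complex_scope.
Local Open Scope ring_scope.

(** * Linear combinations and norms *)

(** That [n] is fixed in advance is what makes a single component usable: isolating it costs a
    factor [n], and the tolerance is chosen after [n]. Isolating it also costs a square root; two
    more are lost when [h] is shown to act almost as a unit on [e] and when [k - k^2] is estimated.
    Hence the fourth powers of the final parameter [s], and the eighth in the tolerance.

    The cut by [p] is needed because nothing controls [g] where [psi e] is small. The threshold
    [1/2] yields two inequalities with constant 2: [p <= 2 psi e] makes [k] almost idempotent, and
    [1 - p <= 2 (1 - psi e)] makes [k] almost a unit.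

    The space [g (p F p)] is closed under products only up to the factor [h], which acts there as
    [k]. A product in [G ** g (p F p)] therefore acquires the factor [k ** G^2], and this must equal
    [G] exactly. Solving that equation avoids both the perturbation of matrix units and the
    structure theorem for order zero maps. *)

(* Equalities between linear combinations are decided by comparing the
   coefficient of each atom with [ring]. *)
Inductive lexp (K V : Type) : Type :=
  | LAtom of nat & V | LZero | LAdd of lexp K V & lexp K V | LOpp of lexp K V
  | LScale of K & lexp K V.
Arguments LZero {K V}.
Arguments LAtom {K V}.

Fixpoint leval (K : nzRingType) (V : lmodType K) (e : lexp K V) : V :=
  match e with
  | LAtom _ v => v | LZero => 0 | LAdd e f => leval e + leval f
  | LOpp e => - leval e | LScale c e => c *: leval e
  end.

(** Atoms carry their vector beside their index, so [leval] of a reified goal converts to the goal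
    without list lookups; this condition says that index and vector agree. *)
Fixpoint lwf (K : nzRingType) (V : lmodType K) (l : nat -> V) (e : lexp K V) : Prop :=
  match e with
  | LAtom n v => l n = v | LZero => True | LAdd e f => lwf l e /\ lwf l f
  | LOpp e => lwf l e | LScale c e => lwf l e
  end.

Fixpoint lcoef (K : nzRingType) (V : lmodType K) (e : lexp K V) (n : nat) : K :=
  match e with
  | LAtom m _ => if m == n then 1 else 0 | LZero => 0
  | LAdd e f => lcoef e n + lcoef f n
  | LOpp e => - lcoef e n | LScale c e => c * lcoef e n
  end.

Fixpoint lbound (K : nzRingType) (V : lmodType K) (N : nat) (e : lexp K V) : bool :=
  match e with
  | LAtom m _ => (m < N)%N | LZero => true
  | LAdd e f => lbound N e && lbound N f
  | LOpp e => lbound N e | LScale c e => lbound N e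
  end.

Lemma leval_coef (K : nzRingType) (V : lmodType K) (l : nat -> V) N (e : lexp K V) :
  lwf l e -> lbound N e -> leval e = \sum_(i < N) lcoef e i *: l i.
Proof.
elim: e => [m v|| e IHe f IHf| e IHe| c e IHe] /=.
- move=> <- mN; rewrite (bigD1 (Ordinal mN)) //= eqxx scale1r big1 ?addr0 // => i.
  by rewrite -val_eqE /= eq_sym => /negbTE ->; rewrite scale0r.
- by move=> _ _; rewrite big1 // => i _; rewrite scale0r.
- move=> [we wf] /andP[be bf]; rewrite IHe // IHf // -big_split /=.
  by apply: eq_bigr => i _; rewrite scalerDl.
- by move=> we be; rewrite IHe // -sumrN; apply: eq_bigr => i _; rewrite scaleNr.
- move=> we be; rewrite IHe // scaler_sumr.
  by apply: eq_bigr => i _; rewrite scalerA.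
Qed.

(** Recursive rather than quantified, so that simplification leaves one scalar equation per atom. *)
Fixpoint eq_upto (K : Type) (f g : nat -> K) (N : nat) : Prop :=
  if N is M.+1 then f M = g M /\ eq_upto f g M else True.

Lemma leval_eq (K : nzRingType) (V : lmodType K) (s : seq V) (e f : lexp K V) :
  lwf (nth 0 s) e -> lwf (nth 0 s) f -> lbound (size s) e -> lbound (size s) f ->
  eq_upto (lcoef e) (lcoef f) (size s) -> leval e = leval f.
Proof.
move=> we wf be bf H; rewrite (leval_coef we be) (leval_coef wf bf).
apply: eq_bigr => i _; congr (_ *: _).
elim: (size s) i H => [[] //|n IH i /= [H1 H2]].
case: (ltngtP i n) => [lt_in|gt_in|->//]; last by have := ltn_ord i; rewrite ltnS leqNgt gt_in.
exact: (IH (Ordinal lt_in)).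
Qed.

Ltac l_index v s :=
  lazymatch s with
  | v :: _ => constr:(0%N)
  | _ :: ?t => let n := l_index v t in constr:(n.+1)
  end.

Ltac l_insert v s :=
  lazymatch s with
  | nil => constr:(v :: nil)
  | v :: _ => s
  | ?w :: ?t => let t' := l_insert v t in constr:(w :: t')
  end.

Ltac l_atoms t s :=
  lazymatch t with
  | GRing.add ?a ?b => let s1 := l_atoms a s in l_atoms b s1
  | GRing.opp ?a => l_atoms a s
  | GRing.scale ?c ?a => l_atoms a s
  | GRing.zero => s
  | _ => l_insert t s
  end.

Ltac l_reify K V t s :=
  lazymatch t with
  | GRing.add ?a ?b => let a' := l_reify K V a s in let b' := l_reify K V b s in
      constr:(@LAdd K V a' b')
  | GRing.opp ?a => let a' := l_reify K V a s in constr:(@LOpp K V a')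
  | GRing.scale ?c ?a => let a' := l_reify K V a s in constr:(@LScale K V c a')
  | GRing.zero => constr:(@LZero K V)
  | _ => let n := l_index t s in constr:(@LAtom K V n t)
  end.

Ltac lmod_with K V :=
  lazymatch goal with
  | |- ?x = ?y =>
    let s0 := constr:(@nil V) in
    let s1 := l_atoms x s0 in
    let s2 := l_atoms y s1 in
    let e := l_reify K V x s2 in
    let f := l_reify K V y s2 in
    refine (@leval_eq _ _ s2 e f _ _ _ _ _);
    [ by do ?split | by do ?split | by [] | by [] | rewrite /=; do ?split ]
  end.

Section Norm.
Context {R : realType}.
Implicit Types A : cstarAlgType R.

Lemma rnormE A (a : A) : `|a| = (rnorm a)%:C.
Proof.
by rewrite /rnorm RRe_real // ger0_real.
Qed.

Lemma rnorm_ge0 A (a : A) : 0 <= rnorm a.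
Proof. by rewrite -lecR -rnormE normr_ge0. Qed.

Lemma rnorm0 A : rnorm (0 : A) = 0.
Proof. by rewrite /rnorm normr0. Qed.

Lemma rnorm_eq0 A (a : A) : rnorm a = 0 -> a = 0.
Proof. by move=> a0; apply/eqP; rewrite -normr_eq0 rnormE a0. Qed.

Lemma rnormD A (a b : A) : rnorm (a + b) <= rnorm a + rnorm b.
Proof. by rewrite -lecR rmorphD /= -!rnormE ler_normD. Qed.

Lemma rnormN A (a : A) : rnorm (- a) = rnorm a.
Proof. by rewrite /rnorm normrN. Qed.

Lemma rnormB A (a b : A) : rnorm (a - b) <= rnorm a + rnorm b.
Proof. by rewrite -(rnormN b) rnormD. Qed.

Lemma rnorm_sub A (a b : A) : rnorm (a - b) = rnorm (b - a).
Proof. by rewrite -rnormN opprB. Qed.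

Lemma complexI_eq (x y : R) : x%:C = y%:C :> R[i] -> x = y.
Proof. by case. Qed.

Lemma rnormZ A (t : R) (a : A) : rnorm (t%:C *: a) = `|t| * rnorm a.
Proof.
apply: complexI_eq; rewrite -rnormE normrZ rnormE rmorphM; congr (_ * _).
by rewrite normc_def /= expr0n addr0 sqrtr_sqr.
Qed.

Lemma rnormZc A (c : R[i]) (a : A) : rnorm (c *: a) = complex.Re `|c| * rnorm a.
Proof.
by apply: complexI_eq; rewrite -rnormE normrZ rnormE rmorphM /= RRe_real ?ger0_real.
Qed.

Lemma rnormZi A (a : A) : rnorm ('i *: a) = rnorm a.
Proof. by rewrite rnormZc normc_def /= expr0n expr1n add0r sqrtr1 mul1r. Qed.

Lemma rnormM A (a b : A) : rnorm (a ** b) <= rnorm a * rnorm b.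
Proof. by rewrite -lecR rmorphM /= -!rnormE norm_smul. Qed.

Lemma rnorm_cstar A (a : A) : rnorm (star a ** a) = rnorm a ^+ 2.
Proof. by apply: complexI_eq; rewrite -rnormE cstar_identity rnormE rmorphXn. Qed.

Lemma rnorm_star A (a : A) : rnorm (star a) = rnorm a.
Proof.
suff H b : rnorm b <= rnorm (star b :> A).
  by apply/eqP; rewrite eq_le H -{2}(starK a) H.
have := rnormM (star b) b; rewrite rnorm_cstar expr2.
have [->|b0] := eqVneq (rnorm b) 0; first by rewrite rnorm_ge0.
by rewrite ler_pM2r // lt_neqAle eq_sym b0 rnorm_ge0.
Qed.

Lemma star0 A : star 0 = 0 :> A.
Proof. by rewrite -(scale0r 0) starZ conjc0 !scale0r. Qed.

Lemma starN A (a : A) : star (- a) = - star a.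
Proof. by rewrite -scaleN1r starZ rmorphN1 scaleN1r. Qed.

Lemma starB A (a b : A) : star (a - b) = star a - star b.
Proof. by rewrite starD starN. Qed.

Lemma starZr A (t : R) (a : A) : star (t%:C *: a) = t%:C *: star a.
Proof. by rewrite starZ conjc_real. Qed.

Lemma starZi A (a : A) : star ('i *: a) = - 'i *: star a.
Proof. by rewrite starZ; congr (_ *: _); apply/eqP; rewrite eq_complex /= oppr0 !eqxx. Qed.

Lemma smulNl A (a b : A) : (- a) ** b = - (a ** b).
Proof. by rewrite -scaleN1r smulZl scaleN1r. Qed.

Lemma smulNr A (a b : A) : a ** (- b) = - (a ** b).
Proof. by rewrite -scaleN1r smulZr scaleN1r. Qed.

Lemma smul0l A (a : A) : 0 ** a = 0.
Proof. by rewrite -(scale0r a) smulZl !scale0r. Qed.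

Lemma smul0r A (a : A) : a ** 0 = 0.
Proof. by rewrite -(scale0r a) smulZr !scale0r. Qed.

Lemma star_sum A n (f : 'I_n -> A) : star (\sum_i f i) = \sum_i star (f i).
Proof. by apply: (big_morph star (@starD _ A)); rewrite star0. Qed.

Lemma smul_suml A n (f : 'I_n -> A) b : (\sum_i f i) ** b = \sum_i f i ** b.
Proof.
by apply: (big_morph (fun x => x ** b)) => [x y|]; rewrite ?smulDl ?smul0l.
Qed.

Lemma smul_sumr A n (f : 'I_n -> A) b : b ** (\sum_i f i) = \sum_i b ** f i.
Proof.
by apply: (big_morph (fun x => b ** x)) => [x y|]; rewrite ?smulDr ?smul0r.
Qed.

Lemma rnorm_sa A (a : A) : star a = a -> rnorm (a ** a) = rnorm a ^+ 2.
Proof. by move=> sa; rewrite -{1}sa rnorm_cstar. Qed.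

Definition expandE := (@smulDl R, @smulDr R, @smulNl, @smulNr, @smulZl R, @smulZr R,
  @smul0l, @smul0r, @starB, @starD R, @starN, @starZr, @starZi, @starM R,
  @starK R, @star0, @smulA R).

End Norm.

Ltac lmod :=
  match goal with
  | |- @eq ?V _ _ =>
      match V with
      | context [?A] =>
        lazymatch type of A with
        | CStarAlgebra.type ?R =>
          let W := constr:(CStarAlgebra.sort A) in lmod_with (complex R) W
        end
      end
  end.

(** * Adjointable operators *)

Section Limits.
Context {R : realType}.
Implicit Types A B : cstarAlgType R.

Definition tends A (u : nat -> A) (l : A) : Prop :=
  forall eps : R, 0 < eps ->
    exists N : nat, forall n, (N <= n)%N -> rnorm (u n - l) <= eps.

Lemma rnorm_small_eq0 A (a : A) : (forall eps : R, 0 < eps -> rnorm a <= eps) -> a = 0.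
Proof.
move=> H; apply: rnorm_eq0; apply/eqP; rewrite eq_le rnorm_ge0 andbT.
by apply/ler_addgt0Pl => e e0; rewrite addr0 H.
Qed.

Lemma tends_unique A (u : nat -> A) l l' : tends u l -> tends u l' -> l = l'.
Proof.
move=> H H'; apply/eqP; rewrite -subr_eq0; apply/eqP; apply: rnorm_small_eq0 => e e0.
have e2 : 0 < e / 2 by lra.
have [N HN] := H _ e2; have [M HM] := H' _ e2.
have -> : l - l' = (u (maxn N M) - l') - (u (maxn N M) - l) by lmod; ring.
apply: le_trans (rnormB _ _) _.
have := HN _ (leq_maxl N M); have := HM _ (leq_maxr N M); lra.
Qed.

Lemma tends_const A (l : A) : tends (fun=> l) l.
Proof. by move=> e e0; exists 0%N => n _; rewrite subrr rnorm0 ltW. Qed.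

Lemma tendsD A (u v : nat -> A) k l :
  tends u k -> tends v l -> tends (fun n => u n + v n) (k + l).
Proof.
move=> H H' e e0; have e2 : 0 < e / 2 by lra.
have [N HN] := H _ e2; have [M HM] := H' _ e2.
exists (maxn N M) => n; rewrite geq_max => /andP[/HN Hn /HM Hm].
have -> : u n + v n - (k + l) = (u n - k) + (v n - l) by lmod; ring.
by apply: le_trans (rnormD _ _) _; lra.
Qed.

Lemma tends_lip A B (f : A -> B) (M : R) (u : nat -> A) l :
  (forall x y, rnorm (f x - f y) <= M * rnorm (x - y)) ->
  tends u l -> tends (fun n => f (u n)) (f l).
Proof.
move=> Hf Hu e e0.
have M0 : 0 < `|M| + 1 by have := normr_ge0 M; lra.
have [N HN] := Hu (e / (`|M| + 1)) (divr_gt0 e0 M0); exists N => n /HN Hn.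
apply: le_trans (Hf _ _) _.
have : rnorm (u n - l) * (`|M| + 1) <= e by rewrite -ler_pdivlMr.
have := rnorm_ge0 (u n - l); have := ler_norm M; nra.
Qed.

Lemma tends_shift A (u : nat -> A) l : tends u l -> tends (fun n => u n.+1) l.
Proof. by move=> H e e0; have [N HN] := H e e0; exists N => n Nn; apply/HN/leqW. Qed.

Lemma tends_rnorm_le A (u : nat -> A) l (M : R) :
  tends u l -> (forall n, rnorm (u n) <= M) -> rnorm l <= M.
Proof.
move=> H HM; apply/ler_addgt0Pl => e e0; have [N HN] := H e e0.
have -> : l = u N - (u N - l) by lmod; ring.
by apply: le_trans (rnormB _ _) _; have := HN _ (leqnn N); have := HM N; lra.
Qed.

(** Majorant method: [v] is nondecreasing and bounded, so beyond some index its increments, and with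
    them those of [u], are small. It serves both the square root and Newton's iteration. *)
Lemma complete_dominated A (u : nat -> A) (v : nat -> R) (b : R) :
  (forall k m, (k <= m)%N -> rnorm (u m - u k) <= v m - v k) ->
  (forall n, v n <= b) -> exists l, tends u l.
Proof.
move=> Huv vb.
have hs : has_sup (range v).
  by split; [exists (v 0%N); exists 0%N | exists b => _ [n _ <-]].
have key (e : R) : 0 < e -> exists N : nat, forall n, (N <= n)%N -> rnorm (u n - u N) <= e / 2.
  move=> e0; have e2 : 0 < e / 2 by lra.
  have [_ [N _ <-] HN] := sup_adherent e2 hs; exists N => n Nn.
  apply: le_trans (Huv _ _ Nn) _.
  have : v n <= sup (range v) by apply: sup_upper_bound => //; exists n.
  lra.
have hc : cauchy (u @ \oo).
  apply: cauchy_exP => e e0.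
  have eE : e = (complex.Re e)%:C by rewrite RRe_real // gtr0_real.
  have e0' : 0 < complex.Re e by rewrite -ltcR -eE.
  have [N HN] := key _ e0'; exists (u N), N => // n /= Nn.
  rewrite -ball_normE /= rnormE eE ltcR rnorm_sub.
  by apply: le_lt_trans (HN _ Nn) _; lra.
have hl : cvg (u @ \oo) by exact: (@cauchy_cvg A _ _ hc).
move/cvg_ex: hl => [l Hl].
exists l => e e0; have ec0 : 0 < e%:C :> R[i] by rewrite ltcR.
have /cvgrPdist_le /(_ _ ec0) [N _ HN] := Hl.
by exists N => n /HN /=; rewrite rnormE lecR rnorm_sub.
Qed.

End Limits.

(** * Adjointable maps as a substitute for a unitization *)

Section Operators.
Context {R : realType} {A : cstarAlgType R}.
Implicit Types (S T V B C : A -> A) (t s : R).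

(* Since [A] may lack a unit, order relations such as [a <= t.1] are expressed
   with maps [A -> A] adjointable for the inner product [star y ** z], among
   which are the left multiplications and the identity. *)
Definition adj T T' : Prop := forall y z, star (T y) ** z = star y ** T' z.

Definition bnd T t : Prop := forall z, rnorm (T z) <= t * rnorm z.

Definition comm S T : Prop := forall z, S (T z) = T (S z).

(** For self-adjoint [T] the bound [|t - T| <= t] expresses a nonnegative spectrum without
    mentioning it. Sums are then easy; that [B' B] qualifies is the hard fact [pos_square]. *)
Definition pos T : Prop :=
  adj T T /\ exists2 t, 0 <= t & bnd (fun z => t%:C *: z - T z) t.

Lemma smul_star_inj (a b : A) : (forall y, star y ** a = star y ** b) -> a = b.
Proof.
move=> H; apply/eqP; rewrite -subr_eq0; apply/eqP/rnorm_eq0/eqP.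
by rewrite -sqrf_eq0 -rnorm_cstar smulDr smulNr H subrr rnorm0.
Qed.

Lemma adj_sym T T' : adj T T' -> adj T' T.
Proof. by move=> H y z; apply: (can_inj (@starK R A)); rewrite !starM !starK H. Qed.

Lemma adjDr T T' : adj T T' -> {morph T' : x y / x + y}.
Proof. by move=> H x y; apply: smul_star_inj => w; rewrite smulDr -!H smulDr. Qed.

Lemma adjZr T T' (c : R[i]) : adj T T' -> {morph T' : x / c *: x}.
Proof. by move=> H x; apply: smul_star_inj => w; rewrite smulZr -!H smulZr. Qed.

(** Having an adjoint forces linearity, so bare functions suffice. The nested product serves as a
    multi-rule for [rewrite]. *)
Lemma adj_linear T T' : adj T T' ->
  prod (prod {morph T : x y / x - y} {morph T : x y / x + y})
    (prod (prod {morph T : x / - x} (forall c : R[i], {morph T : x / c *: x})) (T 0 = 0)).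
Proof.
move=> /adj_sym H; have D := adjDr H; have Z c := adjZr c H.
have N : {morph T : x / - x} by move=> x; rewrite -scaleN1r Z scaleN1r.
by do !split => //; [move=> x y; rewrite D N | rewrite -(scale0r 0) Z !scale0r].
Qed.

Lemma adj_id : adj id id. Proof. by []. Qed.

Lemma adj0 : adj (fun=> 0) (fun=> 0).
Proof. by move=> y z; rewrite star0 smul0l smul0r. Qed.

Lemma adjD S S' T T' : adj S S' -> adj T T' ->
  adj (fun z => S z + T z) (fun z => S' z + T' z).
Proof. by move=> HS HT y z; rewrite starD smulDl smulDr HS HT. Qed.

Lemma adjN T T' : adj T T' -> adj (fun z => - T z) (fun z => - T' z).
Proof. by move=> HT y z; rewrite starN smulNl smulNr HT. Qed.

Lemma adjZ T T' t : adj T T' -> adj (fun z => t%:C *: T z) (fun z => t%:C *: T' z).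
Proof. by move=> HT y z; rewrite starZr smulZl smulZr HT. Qed.

Lemma adj_comp S S' T T' : adj S S' -> adj T T' ->
  adj (fun z => S (T z)) (fun z => T' (S' z)).
Proof. by move=> HS HT y z; rewrite HS HT. Qed.

Lemma adj_smul (a : A) : adj (smul a) (smul (star a)).
Proof. by move=> y z; rewrite starM smulA. Qed.

Lemma bnd_smul (a : A) : bnd (smul a) (rnorm a).
Proof. by move=> z; exact: rnormM. Qed.

Lemma bndW T t s : bnd T t -> t <= s -> bnd T s.
Proof.
by move=> H ts z; apply: le_trans (H z) _; rewrite ler_wpM2r ?rnorm_ge0.
Qed.

Lemma bndD S T s t : bnd S s -> bnd T t -> bnd (fun z => S z + T z) (s + t).
Proof. by move=> HS HT z; rewrite mulrDl; apply: le_trans (rnormD _ _) (lerD _ _). Qed.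

Lemma bndN T t : bnd T t -> bnd (fun z => - T z) t.
Proof. by move=> H z; rewrite rnormN. Qed.

Lemma bndZ T t s : bnd T t -> bnd (fun z => s%:C *: T z) (`|s| * t).
Proof. by move=> H z; rewrite rnormZ -mulrA ler_wpM2l. Qed.

Lemma bnd_comp S T s t : 0 <= s -> bnd S s -> bnd T t -> bnd (fun z => S (T z)) (s * t).
Proof.
by move=> s0 HS HT z; apply: le_trans (HS _) _; rewrite -mulrA ler_wpM2l.
Qed.

Lemma bnd_adj T T' t : 0 <= t -> adj T T' -> bnd T t -> bnd T' t.
Proof.
move=> t0 HT Ht z; have := rnorm_cstar (T' z); rewrite (adj_sym HT) => E.
have := rnormM (star z) (T (T' z)); rewrite E rnorm_star => H.
have := Ht (T' z); have z0 := rnorm_ge0 z; have := rnorm_ge0 (T' z).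
rewrite le_eqVlt => /predU1P[<- _|a0 Hw]; first exact: mulr_ge0.
by rewrite -(ler_pM2r a0); nra.
Qed.

Lemma bnd_sq T T' t : 0 <= t -> adj T T' -> bnd (fun z => T' (T z)) (t ^+ 2) -> bnd T t.
Proof.
move=> t0 HT Ht z; have := rnorm_cstar (T z); rewrite HT => E.
have := rnormM (star z) (T' (T z)); rewrite E rnorm_star => H.
have := Ht z => Hz.
have : rnorm (T z) ^+ 2 <= (t * rnorm z) ^+ 2.
  by have := rnorm_ge0 z; nra.
by rewrite ler_sqr ?nnegrE ?rnorm_ge0 ?mulr_ge0 ?rnorm_ge0.
Qed.

Lemma bnd_lip T T' t : adj T T' -> bnd T t ->
  forall x y, rnorm (T x - T y) <= t * rnorm (x - y).
Proof. by move=> HT Ht x y; rewrite -(adj_linear HT). Qed.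

End Operators.

(** * Square roots by iteration *)

Section SquareRoot.
Context {R : realType} {A : cstarAlgType R}.
Implicit Types (S T V B C D : A -> A) (t s : R).

Definition bop T T' : Prop := adj T T' /\ exists2 t : R, 0 <= t & bnd T t.

Lemma bop_id : bop id id.
Proof. by split=> //; exists 1 => // z; rewrite mul1r. Qed.

Lemma bop_smul (a : A) : bop (smul a) (smul (star a)).
Proof.
split; first exact: adj_smul.
by exists (rnorm a); [exact: rnorm_ge0 | exact: bnd_smul].
Qed.

Lemma bopD S S' T T' : bop S S' -> bop T T' ->
  bop (fun z => S z + T z) (fun z => S' z + T' z).
Proof.
move=> [HS [s s0 Hs]] [HT [t t0 Ht]]; split; first exact: adjD.
by exists (s + t); [exact: addr_ge0 | exact: bndD].
Qed.

Lemma bopN T T' : bop T T' -> bop (fun z => - T z) (fun z => - T' z).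
Proof.
move=> [HT [t t0 Ht]]; split; first exact: adjN.
by exists t => //; exact: bndN.
Qed.

Lemma bopZ T T' t : bop T T' -> bop (fun z => t%:C *: T z) (fun z => t%:C *: T' z).
Proof.
move=> [HT [s s0 Hs]]; split; first exact: adjZ.
by exists (`|t| * s); [exact: mulr_ge0 | exact: bndZ].
Qed.

Lemma bop_comp S S' T T' : bop S S' -> bop T T' ->
  bop (fun z => S (T z)) (fun z => T' (S' z)).
Proof.
move=> [HS [s s0 Hs]] [HT [t t0 Ht]]; split; first exact: adj_comp.
by exists (s * t); [exact: mulr_ge0 | exact: bnd_comp].
Qed.

Lemma bop_sym T T' : bop T T' -> bop T' T.
Proof.
move=> [HT [s s0 Hs]]; split; first exact: adj_sym.
by exists s => //; exact: bnd_adj HT Hs.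
Qed.

Fixpoint sqn T n z : A :=
  if n is m.+1 then (2^-1 : R)%:C *: (T z + sqn T m (sqn T m z)) else 0.

(** The same iteration at the scalar [1]: it increases inside [[0, 1]] and is the majorant for
    [sqn]. *)
Fixpoint sqv n : R := if n is m.+1 then 2^-1 * (1 + sqv m * sqv m) else 0.

Lemma sqv_01 n : 0 <= sqv n <= 1.
Proof. elim: n => [|n IH] /=; first by rewrite lexx ler01. by nra. Qed.

Lemma sqv_le k m : (k <= m)%N -> sqv k <= sqv m.
Proof.
elim: m k => [|m IHm] [|k] //= km; first by have /andP[] := sqv_01 m.+1.
have := IHm _ km; have /andP[vm0 _] := sqv_01 m; have /andP[vk0 _] := sqv_01 k => vkm.
by rewrite ler_pM2l ?invr_gt0 // lerD2l; apply: ler_pM.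
Qed.

Section Iteration.
Variables (T : A -> A) (HT : adj T T) (T1 : bnd T 1).

Lemma sqn_adj n : adj (sqn T n) (sqn T n).
Proof.
elim: n => [|n IH] /=; first exact: adj0.
exact: adjZ (adjD HT (adj_comp IH IH)).
Qed.

Lemma sqn_bnd n : bnd (sqn T n) (sqv n).
Proof.
elim: n => [|n IH] /=; first by move=> z; rewrite rnorm0 mul0r.
have /andP[v0 _] := sqv_01 n.
have := bndZ (2^-1 : R) (bndD T1 (bnd_comp v0 IH IH)).
by rewrite ger0_norm // invr_ge0.
Qed.

Lemma sqn_comm V V' n : adj V V' -> comm V T -> comm V (sqn T n).
Proof.
move=> HV VT; elim: n => [|n IH] z /=; first by rewrite (adj_linear HV).
by rewrite !(adj_linear HV) VT !IH.
Qed.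

Lemma sqn_comm2 m n : comm (sqn T m) (sqn T n).
Proof.
apply: (sqn_comm n (sqn_adj m)) => z.
by rewrite (sqn_comm m HT (fun _ => erefl)).
Qed.

(** The iterates commute, so [S^2 - S'^2 = (S - S') (S + S')]. The scalar majorant factors in the
    same way with equality, so the induction closes without loss. *)
Lemma sqn_diff k m : (k <= m)%N -> bnd (fun z => sqn T m z - sqn T k z) (sqv m - sqv k).
Proof.
elim: k m => [m _ z /=|k IH [//|m] km z] /=; first by rewrite !subr0; exact: sqn_bnd.
set S := sqn T m; set S' := sqn T k.
have -> : (2^-1 : R)%:C *: (T z + S (S z)) - (2^-1 : R)%:C *: (T z + S' (S' z)) =
  (2^-1 : R)%:C *: (S (S z + S' z) - S' (S z + S' z)).
  rewrite !(adj_linear (sqn_adj m : adj S S)) !(adj_linear (sqn_adj k : adj S' S')).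
  by rewrite (sqn_comm2 k m z : S' (S z) = S (S' z)); lmod; ring.
have /andP[v0 _] := sqv_01 m; have /andP[v1 _] := sqv_01 k.
rewrite rnormZ ger0_norm ?invr_ge0 //.
have H1 := IH m km (S z + S' z).
have H2 := bndD (sqn_bnd m) (sqn_bnd k) z.
have z0 := rnorm_ge0 z.
have kmv : sqv k <= sqv m by exact: sqv_le.
have : rnorm (S (S z + S' z) - S' (S z + S' z)) <=
    (sqv m - sqv k) * ((sqv m + sqv k) * rnorm z).
  by apply: le_trans H1 _; apply: ler_wpM2l; [rewrite subr_ge0 | exact: H2].
nra.
Qed.

(** The fixed point equation says [(1 - S)^2 = 1 - T]. Commutation passes to [S] because the
    iterates are polynomials in [T]; every later commutation of roots comes from this clause. *)
Lemma sqrt_one_sub : exists S,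
  [/\ adj S S, bnd S 1,
     forall z, S z = (2^-1 : R)%:C *: (T z + S (S z)) &
     forall V V', bop V V' -> comm V T -> comm V S].
Proof.
have lim z : exists l, tends (fun n => sqn T n z) l.
  apply: (@complete_dominated _ _ _ (fun n => sqv n * rnorm z) (rnorm z)) => [k m km|n].
    by rewrite -mulrBl; exact: sqn_diff.
  by have := sqv_01 n; have := rnorm_ge0 z; nra.
have /choice[S HS] := lim.
have bS n : bnd (sqn T n) 1 by apply: bndW (sqn_bnd n) _; have /andP[] := sqv_01 n.
have tS (u : nat -> A) l : tends u l -> tends (fun n => sqn T n (u n)) (S l).
  move=> ul.
  have -> : (fun n => sqn T n (u n)) = (fun n => sqn T n (u n - l) + sqn T n l).
    by apply/funext => n; rewrite !(adj_linear (sqn_adj n)); lmod; ring.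
  rewrite -(add0r (S l)); apply: tendsD => // e e0.
  have [N HN] := ul e e0; exists N => n /HN; rewrite subr0; apply: le_trans.
  by rewrite -[leRHS]mul1r; exact: bS.
exists S; split.
- move=> y z; apply: (@tends_unique _ _ (fun n => star (sqn T n y) ** z)).
    apply: (tends_lip (f := fun x => star x ** z) (M := rnorm z)) (HS y) => a b.
    by rewrite -smulNl -starN -smulDl -starD mulrC -(rnorm_star (a - b)); exact: rnormM.
  under [X in tends X]eq_fun do rewrite sqn_adj.
  apply: (tends_lip (f := smul (star y)) (M := rnorm y)) (HS z) => a b.
  by rewrite -smulNr -smulDr -(rnorm_star y); exact: rnormM.
- by move=> z; apply: tends_rnorm_le (HS z) _ => n; exact: bS.
- move=> z; apply: tends_unique (tends_shift (HS z)) _ => /=.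
  apply: (tends_lip (f := fun x => (2^-1 : R)%:C *: x) (M := 2^-1)).
    by move=> a b; rewrite -scalerBr rnormZ ger0_norm // invr_ge0.
  by apply: tendsD; [exact: tends_const | exact: tS].
- move=> V V' [HV [t t0 Ht]] VT z.
  apply: tends_unique (tends_lip (bnd_lip HV Ht) (HS z)) _.
  by under [X in tends X]eq_fun do rewrite (sqn_comm _ HV VT); exact: HS.
Qed.

End Iteration.

(* [D + iB] is [sqrt t] times a unitary, and [D], [B] are its real and
   imaginary parts. *)
Lemma pythagoras_bnd D B t : adj D D -> adj B B -> comm D B -> 0 <= t ->
  (forall z, D (D z) + B (B z) = t%:C *: z) -> bnd D (Num.sqrt t).
Proof.
move=> HD HB DB t0 E.
pose U z := D z + 'i *: B z; pose U' z := D z - 'i *: B z.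
have HU : adj U U'.
  by move=> y z; rewrite /U /U' !expandE HD HB; lmod; ring.
have ii : 'i * 'i = -1 :> R[i] by rewrite -expr2 sqrCi.
have bU : bnd U (Num.sqrt t).
  apply: bnd_sq HU _; rewrite ?sqrtr_ge0 // sqr_sqrtr // => z.
  have -> : U' (U z) = D (D z) + B (B z).
    rewrite /U /U' !(adj_linear HD) !(adj_linear HB) DB scalerDr scalerA ii.
    by lmod; ring.
  by rewrite E rnormZ ger0_norm.
have bU' := bnd_adj (sqrtr_ge0 t) HU bU.
move=> z; have -> : D z = (2^-1 : R)%:C *: (U z + U' z).
  by rewrite /U /U'; lmod; field.
have := bndZ (2^-1 : R) (bndD bU bU') z; rewrite ger0_norm ?invr_ge0 //.
by congr (_ <= _ * _); field.
Qed.

(** With [C = sqrt (1 - T^2)] one has [C^2 + T^2 = 1], so [C] is the real part of a unitary, hence a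
    contraction, and so is [C^2 = 1 - T^2]. This is what makes self-adjoint squares positive. *)
Lemma bnd_one_sub_sq T : adj T T -> bnd T 1 -> bnd (fun z => z - T (T z)) 1.
Proof.
move=> HT T1.
have T2 : bnd (fun z => T (T z)) 1 by rewrite -(mulr1 1); exact: bnd_comp.
have [S [HS S1 SE SC]] := sqrt_one_sub (adj_comp HT HT) T2.
have TS : comm T S by apply: (SC T T) => //; split => //; exists 1.
pose C z := z - S z.
have HC : adj C C by apply: adjD (@adj_id _ A) (adjN HS).
have CC z : C (C z) = z - T (T z).
  have E := SE z; rewrite /C !(adj_linear HS).
  move: (S (S z)) E => w E.
  have -> : w = (2 : R)%:C *: S z - T (T z) by rewrite E; lmod; field.
  by lmod; ring.
have TC : comm T C by move=> z; rewrite /C !(adj_linear HT) TS.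
have bC : bnd C (Num.sqrt 1).
  apply: (@pythagoras_bnd C T 1) => // z.
  by rewrite CC; lmod; ring.
rewrite sqrtr1 in bC.
have -> : (fun z => z - T (T z)) = (fun z => C (C z)) by apply/funext => z; rewrite CC.
by rewrite -(mulr1 1); exact: bnd_comp.
Qed.

End SquareRoot.

(** * Positivity *)

Section Positivity.
Context {R : realType} {A : cstarAlgType R}.
Implicit Types (S T V B C D : A -> A) (t s : R).

Lemma pos_bop T : pos T -> bop T T.
Proof.
move=> [HT [t t0 Ht]]; split=> //; exists (t + t); first exact: addr_ge0.
move=> z; have -> : T z = t%:C *: z - (t%:C *: z - T z) by lmod; ring.
apply: le_trans (rnormB _ _) _; rewrite mulrDl lerD //.
by rewrite rnormZ ger0_norm.
Qed.

Lemma pos_scalar t : 0 <= t -> pos (fun z : A => t%:C *: z).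
Proof.
move=> t0; split; first exact: adjZ (@adj_id _ A).
by exists t => // z; rewrite subrr rnorm0 mulr_ge0 ?rnorm_ge0.
Qed.

Lemma posD S T : pos S -> pos T -> pos (fun z => S z + T z).
Proof.
move=> [HS [s s0 Hs]] [HT [t t0 Ht]]; split; first exact: adjD.
exists (s + t) => [|z]; first exact: addr_ge0.
have -> : (s + t)%:C *: z - (S z + T z) = (s%:C *: z - S z) + (t%:C *: z - T z).
  by lmod; ring.
by rewrite mulrDl; apply: le_trans (rnormD _ _) (lerD _ _).
Qed.

Lemma posZ T t : 0 <= t -> pos T -> pos (fun z => t%:C *: T z).
Proof.
move=> t0 [HT [s s0 Hs]]; split; first exact: adjZ.
exists (t * s) => [|z]; first exact: mulr_ge0.
have -> : (t * s)%:C *: z - t%:C *: T z = t%:C *: (s%:C *: z - T z) by lmod; ring.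
by rewrite rnormZ ger0_norm // -mulrA ler_wpM2l.
Qed.

(** For [t > 0] the map [X = (t - T) / t] is a self-adjoint contraction with [T = t (1 - X)], so the
    root is [sqrt t] times [sqrt (1 - X)]. For [t = 0] the bound forces [T = 0]. *)
Lemma pos_sqrt T : pos T -> exists S, [/\ pos S, forall z, S (S z) = T z &
  forall V V', bop V V' -> comm V T -> comm V S].
Proof.
move=> [HT [t t0 Ht]]; move: t0; rewrite le_eqVlt => /predU1P[t0|t0].
  exists (fun=> 0); split.
  - split; first exact: adj0.
    by exists 0 => // z; rewrite scale0r subrr rnorm0 mul0r.
  - move=> z; apply/esym/rnorm_eq0/eqP; rewrite eq_le rnorm_ge0 andbT.
    by have := Ht z; rewrite -t0 scale0r sub0r rnormN mul0r.
  - by move=> V V' [/adj_linear HV _] _ z; rewrite HV.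
pose X z := t^-1%:C *: (t%:C *: z - T z).
have XE z : X z = z - t^-1%:C *: T z.
  by rewrite /X scalerBr scalerA -rmorphM mulVf ?gt_eqF // scale1r.
have HX : adj X X.
  exact: adjZ (adjD (adjZ t (@adj_id _ A)) (adjN HT)).
have X1 : bnd X 1.
  have := bndZ t^-1 Ht; rewrite ger0_norm ?invr_ge0 1?ltW // mulVf //.
  by rewrite gt_eqF.
have [S [HS S1 SE SC]] := sqrt_one_sub HX X1.
have r0 := sqrtr_ge0 t.
exists (fun z => (Num.sqrt t)%:C *: (z - S z)); split.
- split; first exact: adjZ (adjD (@adj_id _ A) (adjN HS)).
  exists (Num.sqrt t) => // z.
  have -> : (Num.sqrt t)%:C *: z - (Num.sqrt t)%:C *: (z - S z) = (Num.sqrt t)%:C *: S z.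
    by lmod; ring.
  by rewrite rnormZ ger0_norm // ler_wpM2l // -[leRHS]mul1r.
- move=> z; rewrite !(adj_linear HS); have E := SE z.
  move: (S (S z)) E => w E.
  have -> : w = (2 : R)%:C *: S z - X z by rewrite E; lmod; field.
  have tt : (Num.sqrt t)%:C * (Num.sqrt t)%:C = t%:C :> R[i].
    by rewrite -rmorphM -expr2 sqr_sqrtr // ltW.
  have -> : T z = t%:C *: (z - X z).
    rewrite XE opprB addrCA subrr addr0 scalerA -rmorphM mulfV ?gt_eqF //.
    by rewrite scale1r.
  by rewrite -tt; lmod; ring.
- move=> V V' BV VT; have HV := adj_linear BV.1.
  have VS : comm V S by apply: (SC V V') => // z; rewrite /X !HV VT.
  by move=> z; rewrite !HV VS.
Qed.

Lemma pos_sq T : bop T T -> pos (fun z => T (T z)).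
Proof.
move=> [HT [M M0 HM]]; split; first exact: adj_comp.
have M1 : 0 < M + 1 by lra.
pose X z := (M + 1)^-1%:C *: T z.
have HX : adj X X := adjZ _ HT.
have X1 : bnd X 1.
  apply: bndW (bndZ (M + 1)^-1 HM) _.
  rewrite ger0_norm; last by rewrite invr_ge0 ltW.
  rewrite [_ * M]mulrC.
  by rewrite ler_pdivrMr //; lra.
exists ((M + 1) ^+ 2) => [|z]; first exact: sqr_ge0.
have -> : ((M + 1) ^+ 2)%:C *: z - T (T z) = ((M + 1) ^+ 2)%:C *: (z - X (X z)).
  have Mc : (M + 1)%:C != 0 :> R[i] by rewrite gt_eqF ?ltcR.
  move: Mc; rewrite /X !(adj_linear HT) !rmorphXn !fmorphV /=.
  by move: (M + 1)%:C => c c0; lmod; field.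
rewrite rnormZ ger0_norm ?sqr_ge0 //.
by rewrite ler_wpM2l ?sqr_ge0 // -[leRHS]mul1r; exact: (bnd_one_sub_sq HX X1).
Qed.

(** The roots [U] and [V] commute as well, so [S T = (U V)^2] is the square of a self-adjoint
    map. *)
Lemma posM S T : pos S -> pos T -> comm S T -> pos (fun z => S (T z)).
Proof.
move=> pS pT ST.
have [U [pU UU UC]] := pos_sqrt pS; have [V [pV VV VC]] := pos_sqrt pT.
have bU := pos_bop pU; have bV := pos_bop pV.
have TU : comm T U by apply: UC (pos_bop pT) _ => z; rewrite ST.
have UV : comm U V by apply: VC bU _ => z; rewrite TU.
have bUV : bop (fun z => U (V z)) (fun z => U (V z)).
  have := bop_comp bU bV.
  by have -> : (fun z => V (U z)) = (fun z => U (V z)) by apply/funext => z; rewrite UV.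
have := pos_sq bUV.
have -> // : (fun z => U (V (U (V z)))) = (fun z => S (T z)).
by apply/funext => z; rewrite -UV UU VV.
Qed.

(** The roots [D] of [T] and [B] of [t - T] commute and satisfy [D^2 + B^2 = t], so [pythagoras_bnd]
    gives [|D| <= sqrt t]. *)
Lemma pos_le_bnd T t : 0 <= t -> pos T -> pos (fun z => t%:C *: z - T z) -> bnd T t.
Proof.
move=> t0 pT pT'.
have [D [pD DD DC]] := pos_sqrt pT; have [B [pB BB BC]] := pos_sqrt pT'.
have bD := pos_bop pD.
have DT : comm D T by move=> z; rewrite -!DD.
have DB : comm D B.
  by apply: (BC _ _ bD) => z; rewrite !(adj_linear bD.1) DT.
have bn : bnd D (Num.sqrt t).
  apply: pythagoras_bnd DB t0 _ => [||z]; rewrite ?DD ?BB.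
  - by case: pD.
  - by case: pB.
  - by lmod; ring.
have -> : T = fun z => D (D z) by apply/funext => z; rewrite DD.
rewrite -(sqr_sqrtr t0) expr2; apply: bnd_comp => //; exact: sqrtr_ge0.
Qed.

Lemma bnd_pos_sub T t : 0 <= t -> adj T T -> bnd T t -> pos (fun z => t%:C *: z - T z).
Proof.
move=> t0 HT Ht; split; first exact: adjD (adjZ t (@adj_id _ A)) (adjN HT).
by exists t => // z; have -> : t%:C *: z - (t%:C *: z - T z) = T z by lmod; ring.
Qed.

Lemma bnd_sub_pos T t : 0 <= t -> pos T -> bnd T t -> bnd (fun z => t%:C *: z - T z) t.
Proof.
move=> t0 pT Ht; apply: pos_le_bnd => //; first exact: bnd_pos_sub pT.1 Ht.
have -> // : (fun z => t%:C *: z - (t%:C *: z - T z)) = T.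
by apply/funext => z; lmod; ring.
Qed.

Lemma pos_anti T : pos T -> pos (fun z => - T z) -> forall z, T z = 0.
Proof.
move=> pT pN z; apply/rnorm_eq0/eqP; rewrite eq_le rnorm_ge0 andbT.
rewrite -(mul0r (rnorm z)); apply: pos_le_bnd => //.
by under eq_fun do rewrite scale0r sub0r.
Qed.

Lemma pos_ext S T : pos S -> (forall z, S z = T z) -> pos T.
Proof. by move=> pS /funext <-. Qed.

(* If [X = - C' C] and [Y = C C'] are both positive then [C X = - Y C], so
   [t X + X^2 = - C' (t - Y) C <= t^2] as soon as [t] bounds [C' C]; this
   improves any bound on [C] by a factor [4 / 5]. *)
Lemma pos_opp_square C C' : bop C C' -> pos (fun z => - C' (C z)) -> forall z, C z = 0.
Proof.
move=> bC pX.
have [HC [g g0 Hg]] := bC; have bC' := bop_sym bC; have HC' := bC'.1.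
have LC := adj_linear HC; have LC' := adj_linear HC'.
pose X z := - C' (C z); pose Y z := C (C' z).
have pY : pos Y.
  (* Up to sign, twice the real and imaginary parts of [C]: [P^2 + Q^2 = 2 (C' C + C C')], so adding
     [X = - C' C] to half of it leaves [Y]. *)
  pose P z := C z + C' z; pose Q z := 'i *: (C z - C' z).
  have bP : bop P P.
    have := bopD bC bC'.
    by have -> : (fun z => C' z + C z) = P by apply/funext => z; rewrite /P addrC.
  have bQ : bop Q Q.
    split; first by move=> y z; rewrite /Q !expandE HC HC'; lmod; ring.
    exists (g + g) => [|z]; first exact: addr_ge0.
    rewrite rnormZi; apply: (bndD Hg (bndN (bnd_adj g0 HC Hg))).
  have pPQ := posZ (_ : 0 <= 2^-1) (posD (pos_sq bP) (pos_sq bQ)).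
  have ii : 'i * 'i = -1 :> R[i] by rewrite -expr2 sqrCi.
  have := posD (pPQ _) pX; rewrite invr_ge0 ler0n => /(_ erefl) /pos_ext; apply => z.
  have -> : Q (Q z) = - (C (C z - C' z) - C' (C z - C' z)).
    rewrite {2}/Q; move: (C z - C' z) => w.
    by rewrite /Q LC LC' -scalerBr scalerA ii scaleN1r.
  rewrite /P /Y !LC !LC' rmorphV ?unitfE ?pnatr_eq0 //= rmorph_nat.
  by lmod; field.
suff step t : 0 <= t -> bnd C t -> bnd C (4 / 5 * t).
  have all n : bnd C ((4 / 5) ^+ n * g).
    elim: n => [|n IH]; first by rewrite expr0 mul1r.
    rewrite exprS -mulrA; by apply: step IH; apply: mulr_ge0.
  move=> z; apply: rnorm_small_eq0 => e e0.
  have c0 : (fun n => (4 / 5) ^+ n * (g * rnorm z)) @ \oo --> (0 : R).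
    rewrite -(mul0r (g * rnorm z)); apply: cvgMl.
    by apply: cvg_expr; rewrite ger0_norm; lra.
  have /cvgrPdist_le /(_ _ e0) [N _ HN] := c0.
  apply: le_trans (all N z) _; rewrite -mulrA.
  by apply: le_trans (HN N (leqnn N)); rewrite sub0r normrN ler_norm.
move=> t0 Ht; have t2 : 0 <= t ^+ 2 by exact: sqr_ge0.
have Ht' := bnd_adj t0 HC Ht.
have HX : adj X X by case: pX.
have HY : adj Y Y by case: pY.
have bX : bnd X (t ^+ 2) by rewrite expr2; apply: bndN; exact: bnd_comp.
have bY : bnd Y (t ^+ 2) by rewrite expr2; exact: bnd_comp.
have bZ : bnd (fun z => (t ^+ 2)%:C *: X z + X (X z)) (t ^+ 2 * t ^+ 2).
  have := bndN (bnd_comp t0 Ht' (bnd_comp t2 (bnd_sub_pos t2 pY bY) Ht)).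
  have -> : (fun z => - C' ((t ^+ 2)%:C *: C z - Y (C z))) =
            (fun z => (t ^+ 2)%:C *: X z + X (X z)).
    by apply/funext => z; rewrite /X /Y !LC !LC'; lmod; ring.
  by move/bndW; apply; rewrite (_ : t * (t ^+ 2 * t) = t ^+ 2 * t ^+ 2) //; ring.
apply: (bnd_sq _ HC); first by lra.
have [t_eq|tn0] := eqVneq t 0.
  by move: bX; rewrite t_eq expr0n mulr0 expr0n => bX z; rewrite -rnormN; exact: bX.
have tp : 0 < t by rewrite lt_neqAle eq_sym tn0.
(* Adding [t^4 - t^2 X - X^2 >= 0] and [(X - t^2 / 2)^2 >= 0] gives [2 t^2 X <= 5/4 t^4]. The factor
   for [C] is then below [4/5], since [5/8 <= 16/25]. *)
have : bnd X (5 / 8 * t ^+ 2).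
  have c0 : 0 <= (2 * t ^+ 2)^-1 by rewrite invr_ge0; nra.
  apply: pos_le_bnd => //; first by nra.
  have p1 : pos (fun z => (t ^+ 2 * t ^+ 2)%:C *: z - ((t ^+ 2)%:C *: X z + X (X z))).
    apply: bnd_pos_sub => //; first exact: mulr_ge0.
    exact: adjD (adjZ _ HX) (adj_comp HX HX).
  pose W z := X z - (2^-1 * t ^+ 2)%:C *: z.
  have bW : bop W W.
    exact: bopD (pos_bop pX) (bopN (bopZ _ (@bop_id _ A))).
  apply: pos_ext (posZ c0 (posD p1 (pos_sq bW))) _ => z.
  rewrite /W !(adj_linear HX).
  have tc : t%:C != 0 :> R[i] by rewrite gt_eqF ?ltcR.
  by lmod; rewrite ?rmorphM ?fmorphV /=; field.
move=> bX' z; rewrite -rnormN; apply: le_trans (bX' z) _.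
by rewrite ler_wpM2r ?rnorm_ge0 //; nra.
Qed.

(** Let [a = B' B], [S = sqrt (a^2)] and [M = S - a], twice the negative part. From [a M = - S M] it
    follows that [- (B M)' (B M) = M S M >= 0], so [B M = 0] by [pos_opp_square]. Then
    [a M = S M = 0], hence [M^2 = 0] and [a = S]. *)
Lemma pos_square B B' : bop B B' -> pos (fun z => B' (B z)).
Proof.
move=> bB; have bB' := bop_sym bB.
pose a z := B' (B z); have ba : bop a a := bop_comp bB' bB.
have [S [pS SS SC]] := pos_sqrt (pos_sq ba).
have bS := pos_bop pS.
have La := adj_linear ba.1; have LS := adj_linear bS.1.
have aS : comm a S by exact: (SC a a ba).
pose M z := S z - a z.
have bM : bop M M := bopD bS (bopN ba).
have LM := adj_linear bM.1.
have aM z : a (M z) = - S (M z).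
  by rewrite /M !La !LS SS aS; lmod; ring.
have MS : comm M S by move=> z; rewrite /M !LS aS.
have [K [pK KK KC]] := pos_sqrt pS.
have bK := pos_bop pK.
have MK : comm M K by apply: KC bM MS.
have bKM : bop (fun z => K (M z)) (fun z => K (M z)).
  have := bop_comp bK bM.
  by have -> : (fun z => M (K z)) = (fun z => K (M z)) by apply/funext => z; rewrite MK.
have bC := bop_comp bB bM.
have C0 : forall z, B (M z) = 0.
  apply: (pos_opp_square bC); apply: pos_ext (pos_sq bKM) _ => z.
  by rewrite -[B' _]/(a (M z)) aM LM opprK MK KK MS.
have aM0 z : a (M z) = 0 by rewrite /a C0; have := adj_linear bB'.1 => ->.
have SM0 z : S (M z) = 0 by apply/eqP; rewrite -oppr_eq0 -aM aM0.
have MM0 z : M (M z) = 0 by rewrite {1}/M aM0 SM0 subrr.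
have M0 z : M z = 0.
  apply: rnorm_eq0; apply/eqP; rewrite -sqrf_eq0 -rnorm_cstar bM.1 MM0 smul0r.
  by rewrite rnorm0.
by apply: pos_ext pS _ => z; apply/eqP; rewrite -subr_eq0; apply/eqP; exact: M0.
Qed.

Lemma pos_conj T B B' : pos T -> bop B B' -> pos (fun z => B' (T (B z))).
Proof.
move=> pT bB; have [S [pS SS _]] := pos_sqrt pT.
apply: pos_ext (pos_square (bop_comp (pos_bop pS) bB)) _ => z.
by rewrite SS.
Qed.

Lemma pos_bnd_le S T t : pos S -> pos (fun z => T z - S z) -> 0 <= t ->
  bnd T t -> bnd S t.
Proof.
move=> pS pTS t0 Ht; apply: pos_le_bnd => //.
have HT : adj T T.
  have -> : T = (fun z => (T z - S z) + S z) by apply/funext => z; lmod; ring.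
  by apply: adjD; [case: pTS | case: pS].
apply: pos_ext (posD (bnd_pos_sub t0 HT Ht) pTS) _ => z.
by lmod; ring.
Qed.

End Positivity.

(** * Positive elements and norm comparison *)

Section Order.
Context {R : realType} {A : cstarAlgType R}.
Implicit Types (S T V B C D : A -> A) (t s : R) (a b c x y z : A).

(** Positivity read off the left multiplication, so that elements compare with the identity map
    where a unit is missing. *)
Definition nonneg a : Prop := pos (smul a).

Lemma adj_smul_sa a : adj (smul a) (smul a) <-> star a = a.
Proof.
split=> [H|sa]; last by rewrite -{2}sa; exact: adj_smul.
have E z : star a ** z = a ** z.
  by apply: smul_star_inj => y; rewrite -H starM smulA.
by apply: smul_star_inj => z; have := congr1 star (E z); rewrite !starM starK.
Qed.

Lemma nonneg_sa a : nonneg a -> star a = a.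
Proof. by move=> [/adj_smul_sa]. Qed.

Lemma nonnegD a b : nonneg a -> nonneg b -> nonneg (a + b).
Proof. by move=> Ha Hb; apply: pos_ext (posD Ha Hb) _ => z; rewrite smulDl. Qed.

Lemma nonnegZ a t : 0 <= t -> nonneg a -> nonneg (t%:C *: a).
Proof. by move=> t0 Ha; apply: pos_ext (posZ t0 Ha) _ => z; rewrite smulZl. Qed.

Lemma nonneg0 : nonneg 0.
Proof.
by apply: pos_ext (@pos_scalar _ A 0 (lexx 0)) _ => z; rewrite smul0l scale0r.
Qed.

Lemma nonneg_square b : nonneg (star b ** b).
Proof. by apply: pos_ext (pos_square (bop_smul b)) _ => z; rewrite smulA. Qed.

Lemma nonneg_op T y : pos T -> nonneg (star y ** T y).
Proof.
move=> /pos_sqrt[S [pS SS _]]; have : nonneg (star (S y) ** S y) by exact: nonneg_square.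
by rewrite (pos_bop pS).1 SS.
Qed.

Lemma nonneg_conj y a : nonneg a -> nonneg (star y ** a ** y).
Proof. by rewrite -smulA; exact: nonneg_op. Qed.

(** At [star a] the C*-identity turns the bound into [|a|^2 <= t |a|]. *)
Lemma bnd_smul_rnorm a t : 0 <= t -> bnd (smul a) t -> rnorm a <= t.
Proof.
move=> t0 /(_ (star a)); rewrite -{1}(starK a) rnorm_cstar rnorm_star expr2.
have [->//|a0] := eqVneq (rnorm a) 0.
by rewrite ler_pM2r // lt_neqAle eq_sym a0 rnorm_ge0.
Qed.

Lemma nonneg_bnd_le a T t : nonneg a -> pos (fun z => T z - a ** z) -> 0 <= t ->
  bnd T t -> rnorm a <= t.
Proof. by move=> Ha HT t0 Ht; apply: bnd_smul_rnorm => //; exact: pos_bnd_le HT t0 Ht. Qed.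

Lemma nonneg_rnorm_le a b : nonneg a -> nonneg (b - a) -> rnorm a <= rnorm b.
Proof.
move=> Ha Hb; apply: nonneg_bnd_le Ha _ (rnorm_ge0 b) (@bnd_smul _ _ b).
by apply: pos_ext Hb _ => z; rewrite smulDl smulNl.
Qed.

Lemma sa_pos_one_sub a : star a = a -> rnorm a <= 1 -> pos (fun z => z - a ** z).
Proof.
move=> /adj_smul_sa sa a1; apply: pos_ext (bnd_pos_sub ler01 sa _) _.
  exact: bndW (@bnd_smul _ _ a) a1.
by move=> z; rewrite scale1r.
Qed.

Lemma pos_one_sub_bnd T : pos T -> bnd T 1 -> bnd (fun z => z - T z) 1.
Proof. by move=> pT T1 z; have := bnd_sub_pos ler01 pT T1 z; rewrite scale1r. Qed.

Lemma nonneg_one_sub_bnd a : nonneg a -> rnorm a <= 1 -> bnd (fun z => z - a ** z) 1.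
Proof. by move=> Ha a1; apply: pos_one_sub_bnd => //; exact: bndW (@bnd_smul _ _ a) a1. Qed.

Lemma pos_one_sub T : pos T -> bnd T 1 -> pos (fun z => z - T z).
Proof.
by move=> pT T1; apply: pos_ext (bnd_pos_sub ler01 pT.1 T1) _ => z; rewrite scale1r.
Qed.

(** Since [T - T^2 = T (1 - T)] is a product of commuting positive maps,
    [|T a|^2 = |star a ** T (T a)|] is at most [|star a ** T a|]. *)
Lemma pos_contr_rnorm T a : pos T -> bnd T 1 ->
  rnorm (T a) ^+ 2 <= rnorm (star a ** T a).
Proof.
move=> pT T1; rewrite -rnorm_cstar; apply: nonneg_rnorm_le; first exact: nonneg_square.
have LT := adj_linear pT.1.
rewrite pT.1 -smulNr -smulDr; have := posM pT (pos_one_sub pT T1).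
have cT : comm T (fun z => z - T z) by move=> z; rewrite !LT.
by move=> /(_ cT) /(nonneg_op a); rewrite !LT.
Qed.

Lemma nonneg_closed a :
  (forall e : R, 0 < e -> exists2 r, rnorm r <= e & nonneg (a + r)) -> nonneg a.
Proof.
move=> H; split.
  apply/adj_smul_sa/eqP; rewrite -subr_eq0; apply/eqP/rnorm_small_eq0 => e e0.
  have [r re /nonneg_sa Hr] := H (e / 2) (divr_gt0 e0 (ltr0n _ 2)).
  have -> : star a - a = r - star r.
    by move: Hr; rewrite starD => Hr; rewrite -{2}(addrK r a) -Hr; lmod; ring.
  by apply: le_trans (rnormB _ _) _; rewrite rnorm_star; lra.
have a0 := rnorm_ge0 a.
exists (rnorm a + 1) => [|z]; first by lra.
apply/ler_addgt0Pl => e e0; have z0 := rnorm_ge0 z.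
(* A perturbation of norm at most 1 keeps the constant [|a| + 1] valid for [a + r]; the second term
   makes [r ** z] negligible. *)
have m0 : 0 < Num.min 1 (e / (rnorm z + 1)) by rewrite lt_min ltr01 divr_gt0 // ltr_wpDl.
have [r re Hr] := H _ m0.
have re1 : rnorm r <= 1 by apply: le_trans re _; rewrite ge_min lexx.
have re2 : rnorm r * rnorm z <= e.
  have : rnorm r * (rnorm z + 1) <= e.
    by rewrite -ler_pdivlMr ?ltr_wpDl //; apply: le_trans re _; rewrite ge_min lexx orbT.
  by have := rnorm_ge0 r; nra.
have b1 : bnd (smul (a + r)) (rnorm a + 1).
  apply: bndW (@bnd_smul _ _ _) _; apply: le_trans (rnormD _ _) _; lra.
have := bnd_sub_pos _ Hr b1 z.
have -> : (rnorm a + 1)%:C *: z - a ** z =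
  ((rnorm a + 1)%:C *: z - (a + r) ** z) + r ** z by rewrite smulDl; lmod; ring.
move=> H1; apply: le_trans (rnormD _ _) _; rewrite addrC; apply: lerD.
  by apply: le_trans re2; exact: rnormM.
by apply: H1; lra.
Qed.

End Order.

(** * Approximate units *)

Section ApproximateUnit.
Context {R : realType} {A : cstarAlgType R}.
Implicit Types (a b x z : A).

Variables (x : A) (x_ge0 : nonneg x) (x_le1 : rnorm x <= 1).

(** This is [1 - (1 - x)^m] without a unit; the map [T m] below is [(1 - x)^m]. *)
Fixpoint aunit m : A := if m is k.+1 then aunit k + x - x ** aunit k else 0.

Let T m z : A := z - aunit m ** z.

Lemma aunitS m z : T m.+1 z = T m z - x ** T m z.
Proof. by rewrite /T /= !expandE; lmod; ring. Qed.

Lemma aunit_comm m : comm (smul x) (T m).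
Proof.
elim: m => [|m IH] z; first by rewrite /T /= !smul0l !subr0.
by rewrite !aunitS smulDr smulNr -IH.
Qed.

Lemma aunit_pos_bnd m : pos (T m) /\ bnd (T m) 1.
Proof.
have x1 := sa_pos_one_sub (nonneg_sa x_ge0) x_le1.
elim: m => [|m [IHp IHb]].
  have E z : 1%:C *: z = T 0 z by rewrite /T /= smul0l subr0 scale1r.
  split; first by apply: pos_ext (@pos_scalar _ A 1 ler01) E.
  by move=> z; rewrite -E rnormZ normr1.
have E z : T m z - x ** T m z = T m.+1 z by rewrite aunitS.
split.
  apply: pos_ext (posM x1 IHp _) E => z.
  by rewrite !(adj_linear IHp.1) aunit_comm.
have -> : T m.+1 = fun z => T m z - x ** T m z by apply/funext => z; rewrite E.
by rewrite -(mulr1 1); apply: (bnd_comp ler01 (nonneg_one_sub_bnd x_ge0 x_le1)).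
Qed.

Lemma aunit_sa m : star (aunit m) = aunit m.
Proof.
have [[/adj_linear LT _] _] := aunit_pos_bnd m.
apply/adj_smul_sa => y z; have [[HT _] _] := aunit_pos_bnd m.
by have := HT y z; rewrite /T starB smulDl smulNl smulDr smulNr => /addrI/oppr_inj.
Qed.

Lemma aunit_rnorm m : rnorm (aunit m) <= 1.
Proof.
have [Tp Tb] := aunit_pos_bnd m; apply: bnd_smul_rnorm => //.
have := pos_one_sub_bnd Tp Tb.
have -> // : (fun z => z - T m z) = smul (aunit m).
by apply/funext => z; rewrite /T; lmod; ring.
Qed.

(** Telescoping: [1 - (1 - x)^(m+1)] is the sum of [x (1 - x)^j] for [j <= m], whose smallest term
    is the last. Hence [(m + 1) x (1 - x)^m] is at most [1 - (1 - x)^(m+1)], a contraction. *)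
Lemma aunit_decay m : bnd (fun z => x ** T m z) (m.+1%:R^-1).
Proof.
have key : pos (fun z => z - T m.+1 z - m.+1%:R%:C *: (x ** T m z)).
  elim: m => [|m IH].
    apply: pos_ext (@pos_scalar _ A 0 (lexx 0)) _ => z.
    by rewrite aunitS /T /= smul0l subr0; lmod; ring.
  have [p1 b1] := aunit_pos_bnd 1; have [pm bm] := aunit_pos_bnd m.+1.
  have L1 := adj_linear p1.1; have Lm := adj_linear pm.1.
  have E1 z : T 1 z = z - x ** z by rewrite aunitS /T /= smul0l !subr0.
  have c1 k : comm (T 1) (T k).
    have [pk _] := aunit_pos_bnd k; have Lk := adj_linear pk.1.
    by move=> z; rewrite !E1 !Lk aunit_comm.
  have c2 : comm (fun z => z - T m.+1 z - m.+1%:R%:C *: (x ** T m z)) (T 1).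
    move=> z; rewrite (L1.1.1 (z - T m.+1 z)) (L1.1.1 z) (L1.2.1.2 m.+1%:R%:C).
    by rewrite (c1 m.+1 z) -(c1 m z) !E1 smulDr smulNr.
  have c3 : comm (smul x) (fun z => z - T m.+1 z).
    by move=> z; rewrite smulDr smulNr aunit_comm.
  apply: pos_ext (posD (posM IH p1 c2) (posM x_ge0 (pos_one_sub pm bm) c3)) _ => z.
  rewrite -(c1 m.+1 z) -(c1 m z) (E1 (T m.+1 z)) (E1 (T m z)) -(aunitS m) (E1 z).
  have -> : x ** (z - T m.+1 z) = x ** z - x ** T m.+1 z by rewrite smulDr smulNr.
  by rewrite (aunitS m.+1) -[m.+2]addn1 natrD rmorphD; lmod; ring.
have [pm bm] := aunit_pos_bnd m; have [pm1 bm1] := aunit_pos_bnd m.+1.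
have m0 : 0 < m.+1%:R :> R by rewrite ltr0n.
have px : pos (fun z => x ** T m z) by apply: posM => //; exact: aunit_comm.
have := pos_bnd_le (posZ (ltW m0) px) key ler01 (pos_one_sub_bnd pm1 bm1).
move=> H z; have := H z; rewrite rnormZ (ger0_norm (ltW m0)) mul1r => H1.
by rewrite ler_pdivlMl.
Qed.

(** With [T = 1 - aunit], [|T a|^2 = |T a (star a) T| <= t |T x T|], and the decay of [x T]
    applies. *)
Lemma aunit_left a (t : R) m : 0 < t -> nonneg (t%:C *: x - a ** star a) ->
  rnorm (a - aunit m ** a) ^+ 2 <= t / m.+1%:R.
Proof.
move=> t0 xa; have [pm bm] := aunit_pos_bnd m; have bT := pos_bop pm.
have LT := adj_linear pm.1.
have m0 : 0 < m.+1%:R :> R by rewrite ltr0n.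
have -> : rnorm (a - aunit m ** a) = rnorm (star a - star a ** aunit m).
  by rewrite -rnorm_star starB starM aunit_sa.
rewrite -rnorm_cstar starB starM starK aunit_sa.
have E z : (a - aunit m ** a) ** (star a - star a ** aunit m) ** z =
    T m (a ** (star a ** T m z)).
  by rewrite /T !expandE; lmod; ring.
apply: (@nonneg_bnd_le _ _ _ (fun z => t%:C *: T m (x ** T m z))).
- have := nonneg_square (star a - star a ** aunit m).
  by rewrite starB starM starK aunit_sa.
- apply: pos_ext (pos_conj xa bT) _ => z.
  by rewrite E smulDl smulNl smulZl !LT smulA.
- by rewrite divr_ge0 // ltW.
- have := bndZ t (bnd_comp ler01 bm (@aunit_decay m)).
  by rewrite mul1r (ger0_norm (ltW t0)).
Qed.

End ApproximateUnit.

(** The normalized sum of the [a ** star a] dominates each of them up to the factor [t]. The unit is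
    returned as a square [star d ** d], a form that completely positive maps preserve; since
    [1 - v^2 = (1 - v) + v (1 - v)], squaring doubles the error. *)
Lemma approx_unit (R : realType) (A : cstarAlgType R) (s : seq A) (e : R) : 0 < e ->
  exists d : A, let u := star d ** d in
    rnorm u <= 1 /\ forall a, a \in s -> rnorm (a - u ** a) <= e.
Proof.
move=> e0.
pose y : A := \sum_(a <- s) a ** star a.
have sq (a : A) : nonneg (a ** star a) by have := nonneg_square (star a); rewrite starK.
have y0 : nonneg y.
  by rewrite /y; elim/big_ind: _ => //; [exact: nonneg0 | exact: nonnegD].
pose t : R := rnorm y + 1; have t0 : 0 < t by rewrite /t; have := rnorm_ge0 y; lra.
pose x := t^-1%:C *: y.
have x0 : nonneg x by apply: nonnegZ => //; rewrite invr_ge0 ltW.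
have x1 : rnorm x <= 1.
  rewrite rnormZ ger0_norm; last by rewrite invr_ge0 ltW.
  by rewrite mulrC ler_pdivrMr // mul1r /t; lra.
have tx : t%:C *: x = y by rewrite /x scalerA -rmorphM mulfV ?gt_eqF // scale1r.
have xa a : a \in s -> nonneg (t%:C *: x - a ** star a).
  move=> sa; rewrite tx /y (big_rem a sa) /= [X in nonneg X]addrC addKr.
  by elim/big_ind: _ => //; [exact: nonneg0 | exact: nonnegD].
pose m := Num.truncn (t / (e / 2) ^+ 2).
have e2 : 0 < e / 2 by lra.
have key a : a \in s -> rnorm (a - aunit x m ** a) <= e / 2.
  move=> /xa Ha; have := aunit_left x0 x1 m t0 Ha => H.
  rewrite -ler_sqr ?nnegrE ?rnorm_ge0 ?(ltW e2) //; apply: le_trans H _.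
  rewrite ler_pdivrMr ?ltr0n // mulrC -ler_pdivrMr ?exprn_gt0 //.
  by apply/ltW; rewrite /m real_truncnS_gt ?num_real.
exists (aunit x m); rewrite /= aunit_sa //; have n1 := aunit_rnorm x0 x1 m.
split.
  by apply: le_trans (rnormM _ _) _; have := rnorm_ge0 (aunit x m); nra.
move=> a /key Ha.
have -> : a - aunit x m ** aunit x m ** a =
    (a - aunit x m ** a) + aunit x m ** (a - aunit x m ** a).
  by rewrite !expandE; lmod; ring.
apply: le_trans (rnormD _ _) _; have := rnormM (aunit x m) (a - aunit x m ** a).
by have := rnorm_ge0 (a - aunit x m ** a); nra.
Qed.

(** * Completely positive maps *)

Section CompletelyPositive.
Context {R : realType}.
Implicit Types (A B C : cstarAlgType R).

(** The Gram matrix is [Y^* Y] for the matrix [Y] with [y] as its first row and zeros elsewhere. *)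
Lemma cp_gram A B (f : {linear A -> B}) n (y : 'I_n -> A) : completely_positive f ->
  exists W : 'M[B]_n, forall i j,
    f (star (y i) ** y j) = \sum_k star (W k i) ** W k j.
Proof.
case: n y => [|n] y cpf; first by exists (\matrix_(i, j) 0) => [[]].
have /cpf[W HW] : mxpositive (\matrix_(i, j) (star (y i) ** y j)).
  exists (\matrix_(k, i) if k == 0 then y i else 0); apply/matrixP => i j.
  rewrite !mxE big_ord_recl !mxE /= big1 ?addr0 // => k _.
  by rewrite !mxE /= smul0r.
exists W => i j; have /matrixP /(_ i j) := HW; rewrite !mxE => ->.
by apply: eq_bigr => k _; rewrite !mxE.
Qed.

Lemma cp_square A B (f : {linear A -> B}) b : completely_positive f ->
  exists c, f (star b ** b) = star c ** c.
Proof.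
move=> /(@cp_gram _ _ f 1 (fun=> b))[W /(_ 0 0)].
by rewrite big_ord1 => ->; exists (W 0 0).
Qed.

Lemma cp_comp A B C (g : {linear B -> C}) (f : {linear A -> B}) :
  completely_positive g -> completely_positive f ->
  completely_positive (g \o f : {linear A -> C}).
Proof. by move=> cpg cpf n X /cpf /cpg; rewrite -map_mx_comp. Qed.

(** The element [c] stands in for a unit. For [q = f (c ** a)] and [r = f (c ** star c)], the Gram
    matrix of [a] and [star c], mapped by [f] and evaluated at [(1, -q)], gives
    [f (star a ** a) - 2 q^* q + q^* r q >= 0]; then [q^* (1 - r) q >= 0] is added. *)
Lemma kadison_schwarz_mul A B (f : {linear A -> B}) (a c : A) :
  completely_positive f -> contractive f -> rnorm c <= 1 ->
  nonneg (f (star a ** a) - star (f (c ** a)) ** f (c ** a)).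
Proof.
move=> cpf ctf c1.
pose y (i : 'I_2) := if i == 0 then a else star c.
have [W HW] := cp_gram y cpf.
have := HW 0 0; have := HW 1 0; have := HW 1 1.
rewrite /y /= !starK !big_ord_recl !big_ord0 !addr0.
set a0 := W 0 0; set b0 := W 0 1.
move: (W _ 0) (W _ 1) => a1 b1 Er Eq ->; set q := f (c ** a) in Eq *.
set r := f (c ** star c) in Er.
have r1 : rnorm r <= 1.
  apply: (@le_trans _ _ (rnorm (c ** star c))); first by rewrite -lecR -!rnormE ctf.
  by apply: le_trans (rnormM _ _) _; rewrite rnorm_star; have := rnorm_ge0 c; nra.
have rs : star r = r by rewrite Er starD !starM !starK.
have H1 : nonneg (star q ** (q - r ** q)) := nonneg_op q (sa_pos_one_sub rs r1).
have := nonnegD H1 (nonnegD (nonneg_square (a0 - b0 ** q)) (nonneg_square (a1 - b1 ** q))).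
have E1 : star q ** q = star a0 ** b0 ** q + star a1 ** b1 ** q.
  by rewrite {1}Eq !expandE.
have E2 : star q ** q = star q ** star b0 ** a0 + star q ** star b1 ** a1.
  by rewrite {2}Eq !expandE.
have E3 : star q ** r ** q = star q ** star b0 ** b0 ** q + star q ** star b1 ** b1 ** q.
  by rewrite Er !expandE.
set L := (X in nonneg X -> _); set L' := (X in _ -> nonneg X); suff -> : L = L' by [].
rewrite /L /L' !expandE E3.
have -> : star a0 ** b0 ** q = star q ** q - star a1 ** b1 ** q by rewrite E1; lmod; ring.
have -> : star q ** star b0 ** a0 = star q ** q - star q ** star b1 ** a1.
  by rewrite {1}E2; lmod; ring.
by lmod; ring.
Qed.

Lemma contractive_rnorm A B (f : {linear A -> B}) a : contractive f -> rnorm (f a) <= rnorm a.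
Proof. by move=> H; rewrite -lecR -!rnormE H. Qed.

Lemma kadison_schwarz A B (f : {linear A -> B}) (a : A) :
  completely_positive f -> contractive f ->
  nonneg (f (star a ** a) - star (f a) ** f a).
Proof.
(* Replacing [a] by [u ** a] changes [star (f a) ** f a] by at most [2 |a| |a - u ** a|], hence the
   tolerance [e / (2 (|a| + 1))]. *)
move=> cpf ctf; apply: nonneg_closed => e e0.
have a0 := rnorm_ge0 a; have M0 : 0 < 2 * (rnorm a + 1) by lra.
have [d [u1 /(_ a)]] := approx_unit [:: a] (divr_gt0 e0 M0).
rewrite mem_head => /(_ erefl); set u := star d ** d in u1 *.
rewrite ler_pdivlMr // => Ha.
exists (star (f a) ** f a - star (f (u ** a)) ** f (u ** a)); last first.
  by rewrite addrA subrK; exact: kadison_schwarz_mul.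
have -> : star (f a) ** f a - star (f (u ** a)) ** f (u ** a) =
   star (f a) ** f (a - u ** a) + star (f (a - u ** a)) ** f (u ** a).
  have -> : f (a - u ** a) = f a - f (u ** a) by rewrite linearB.
  by rewrite !expandE; lmod; ring.
apply: le_trans (rnormD _ _) _.
have H1 := rnormM (star (f a)) (f (a - u ** a)).
have H2 := rnormM (star (f (a - u ** a))) (f (u ** a)).
rewrite !rnorm_star in H1 H2.
have H3 := contractive_rnorm a ctf; have H4 := contractive_rnorm (u ** a) ctf.
have H5 := contractive_rnorm (a - u ** a) ctf; have H6 := rnormM u a.
have P1 := rnorm_ge0 (f a); have P2 := rnorm_ge0 (f (a - u ** a)).
have P3 := rnorm_ge0 (f (u ** a)); have P4 := rnorm_ge0 (a - u ** a).
have P5 := rnorm_ge0 u.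
have H7 : rnorm (u ** a) <= rnorm a by nra.
have H8 : rnorm (f a) * rnorm (f (a - u ** a)) <= rnorm a * rnorm (a - u ** a).
  exact: ler_pM.
have H9 : rnorm (f (a - u ** a)) * rnorm (f (u ** a)) <= rnorm (a - u ** a) * rnorm a.
  by apply: ler_pM => //; lra.
nra.
Qed.

End CompletelyPositive.

(** * Finite-dimensional algebras *)

Section PolynomialAction.
Context {R : realType} {A : cstarAlgType R}.
Implicit Types (x y z w : A) (P Q D : {poly R[i]}) (c : R[i]) (r : R).

(** [P(x)] is kept as a map on [A], so that its constant term makes sense without a unit. *)
Definition pact x P y : A := \sum_(i < size P) P`_i *: iter i (smul x) y.

Lemma pactE n x P y : (size P <= n)%N -> pact x P y = \sum_(i < n) P`_i *: iter i (smul x) y.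
Proof.
move=> Pn; rewrite /pact (big_ord_widen n (fun i => P`_i *: iter i (smul x) y) Pn).
rewrite big_mkcond /=; apply: eq_bigr => i _; case: ltnP => // H.
by rewrite nth_default ?scale0r.
Qed.

Lemma pactD x P Q y : pact x (P + Q) y = pact x P y + pact x Q y.
Proof.
pose n := maxn (size P) (size Q).
rewrite !(@pactE n) ?leq_maxl ?leq_maxr ?size_polyD // -big_split /=.
by apply: eq_bigr => i _; rewrite coefD scalerDl.
Qed.

Lemma pactC x c y : pact x c%:P y = c *: y.
Proof. by rewrite (@pactE 1) ?size_polyC ?leq_b1 // big_ord1 coefC. Qed.

Lemma pactMX x P y : pact x (P * 'X) y = pact x P (x ** y).
Proof.
rewrite (@pactE (size P).+1); last first.
  by apply: leq_trans (size_polyMleq _ _) _; rewrite size_polyX addn2.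
rewrite big_ord_recl coefMX scale0r add0r; apply: eq_bigr => i _.
by rewrite coefMX /= -iterSr.
Qed.

Lemma pactX x y : pact x 'X y = x ** y.
Proof. by rewrite -['X]mul1r pactMX pactC scale1r. Qed.

Lemma pactZ x c P y : pact x (c *: P) y = c *: pact x P y.
Proof.
rewrite (@pactE (size P)) ?size_scale_leq // scaler_sumr.
by apply: eq_bigr => i _; rewrite coefZ scalerA.
Qed.

Lemma pact_comm x P y : x ** pact x P y = pact x P (x ** y).
Proof.
rewrite /pact smul_sumr; apply: eq_bigr => i _.
by rewrite smulZr -iterSr.
Qed.

Lemma pactM x P Q y : pact x (P * Q) y = pact x P (pact x Q y).
Proof.
elim/poly_ind: P Q y => [|P c IH] Q y.
  by rewrite mul0r -[0]/(0%:P) !pactC !scale0r.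
rewrite mulrDl !pactD pactC pactMX -mulrA IH mul_polyC pactZ.
by rewrite ['X * Q]mulrC pactMX pact_comm.
Qed.

Lemma pact_right x P y w : pact x P (y ** w) = pact x P y ** w.
Proof.
rewrite /pact smul_suml; apply: eq_bigr => i _; rewrite smulZl; congr (_ *: _).
by elim: (i : nat) => //= k ->; rewrite smulA.
Qed.

Lemma pact_star x P y z : star x = x ->
  star (pact x P y) ** z = star y ** pact x (map_poly conjc P) z.
Proof.
move=> sx; elim/poly_ind: P y z => [|P c IH] y z.
  by rewrite map_poly0 -[0]/(0%:P) !pactC !scale0r star0 smul0l smul0r.
rewrite rmorphD rmorphM /= map_polyX map_polyC /= !pactD !pactMX !pactC.
rewrite starD smulDl smulDr IH starM sx -smulA -pact_comm.
by rewrite starZ smulZl smulZr.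
Qed.

Definition annih x P : Prop := forall y, pact x P y = 0.

(** If [x w = c w], then [star w ** x ** w] is self-adjoint and equals [c] times [star w ** w], so
    [c] is real or [w = 0]. *)
Lemma annih_nonreal x P c : star x = x -> complex.Im c != 0 ->
  annih x (('X - c%:P) * P) -> annih x P.
Proof.
move=> sx c0 H y; have := H y.
rewrite pactM pactD pactX -polyCN pactC; set w := pact x P y => /eqP.
rewrite scaleNr subr_eq0 => /eqP xw.
have : star w ** (x ** w) = star (star w ** (x ** w)).
  by rewrite !starM starK sx smulA.
rewrite xw smulZr starZ starM starK => /eqP; rewrite -subr_eq0 -scalerBl scaler_eq0.
case/orP => [|/eqP ww]; last first.
  by apply: rnorm_eq0; apply/eqP; rewrite -sqrf_eq0 -rnorm_cstar ww rnorm0.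
case: c c0 {H xw} => a b /= b0; rewrite eq_complex /= => /andP[_].
by rewrite opprK -mulr2n mulrn_eq0 (negbTE b0).
Qed.

(** [L = x - r] is self-adjoint, so [|L w|^2 = |star w ** L (L w)|] vanishes. *)
Lemma annih_double x P r : star x = x ->
  annih x (('X - r%:C%:P) * (('X - r%:C%:P) * P)) -> annih x (('X - r%:C%:P) * P).
Proof.
move=> sx H y; have := H y; rewrite !pactM; set L := pact x _.
set w := pact x P y => LL; apply: rnorm_eq0; apply/eqP.
have XE : map_poly conjc ('X - r%:C%:P) = 'X - r%:C%:P :> {poly R[i]}.
  by rewrite rmorphB /= map_polyX map_polyC; congr (_ - _%:P); exact: conjc_real.
by rewrite -sqrf_eq0 -rnorm_cstar /L pact_star // XE -/L LL smul0r rnorm0.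
Qed.

Lemma annih_real_roots x (rs : seq R[i]) D : star x = x ->
  annih x (D * \prod_(z <- rs) ('X - z%:P)) ->
  exists2 s : seq R, uniq s & annih x (D * \prod_(r <- s) ('X - r%:C%:P)).
Proof.
move=> sx; elim: rs D => [|z rs IH] D.
  by rewrite big_nil => H; exists [::]; rewrite ?big_nil.
rewrite big_cons mulrA => /IH[s us Hs].
have [|zn] := eqVneq (complex.Im z) 0; last first.
  exists s => //; apply: (annih_nonreal sx zn); by rewrite mulrCA mulrA.
case: z Hs => r b /= Hs b0; rewrite {b}b0 in Hs.
have [rs0|rs0] := boolP (r \in s); last first.
  by exists (r :: s); rewrite /= ?rs0 ?us // big_cons mulrA.
exists s => //; move: Hs; rewrite (big_rem r rs0) /=.
set E := \prod_(_ <- rem _ _) _ => Hs.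
rewrite mulrCA; apply: annih_double => //.
by rewrite (_ : _ * (_ * _) = D * ('X - r%:C%:P) * (('X - r%:C%:P) * E)) //; ring.
Qed.

(** The [n + 1] powers [x, x^2, ...] have coefficient vectors of length [n], hence satisfy a linear
    relation [P0(x) x = 0], and [P0 * 'X] annihilates. Dropping nonreal and repeated roots leaves
    the spectral theorem for [x] in polynomial form. *)
Lemma finite_annih x n (e : 'I_n -> A) : star x = x ->
  [set: A] = range (fun c : 'I_n -> R[i] => \sum_i c i *: e i) ->
  exists2 s : seq R, uniq s & annih x (\prod_(r <- s) ('X - r%:C%:P)).
Proof.
move=> sx he.
have rep z : exists c : 'I_n -> R[i], z = \sum_i c i *: e i.
  by have : [set: A] z by []; rewrite he => -[c _ <-]; exists c.
have /choice[c Hc] := rep.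
pose M : 'M[R[i]]_(n.+1, n) := \matrix_(j, i) c (iter j (smul x) x) i.
have kM : kermx M != 0.
  rewrite -mxrank_eq0 mxrank_ker subn_eq0 -ltnNge ltnS.
  exact: rank_leq_col.
have /rowV0Pn[u uM u0] := kM.
pose P0 := \poly_(j < n.+1) (u 0 (inord j)).
have P0n : P0 != 0.
  apply/negP => /eqP P00; case/negP: u0; apply/eqP/rowP => j; rewrite mxE.
  by have := congr1 (fun p : {poly _} => p`_j) P00; rewrite coef_poly coef0 ltn_ord inord_val.
have Px : pact x P0 x = 0.
  rewrite (@pactE n.+1) ?size_poly //.
  have -> : \sum_(i < n.+1) P0`_i *: iter i (smul x) x =
      \sum_(k < n) (u *m M) 0 k *: e k.
    under [RHS]eq_bigr do rewrite mxE scaler_suml.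
    rewrite exchange_big /=; apply: eq_bigr => j _.
    rewrite coef_poly ltn_ord inord_val {1}(Hc (iter j _ _)) scaler_sumr.
    by apply: eq_bigr => k _; rewrite mxE scalerA.
  have /sub_kermxP -> := uM.
  by rewrite big1 // => k _; rewrite mxE scale0r.
have [rs rsE] := closed_field_poly_normal (P0 * 'X).
have lc : lead_coef (P0 * 'X) != 0.
  by rewrite lead_coef_eq0 mulf_neq0 // polyX_eq0.
have : annih x (1 * \prod_(z <- rs) ('X - z%:P)).
  move=> y; have : pact x (P0 * 'X) y = 0 by rewrite pactMX pact_right Px smul0l.
  rewrite rsE pactZ mul1r => /eqP; rewrite scaler_eq0 => /orP[|/eqP//].
  by rewrite (negbTE lc).
by move=> /(annih_real_roots sx)[s us Hs]; exists s => //; rewrite mul1r in Hs.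
Qed.

Lemma interpolation (s : seq R) (f : R -> R) : uniq s ->
  exists P : {poly R[i]}, forall r, r \in s -> P.[r%:C] = (f r)%:C.
Proof.
elim: s => [_|r s IH /= /andP[rs /IH[P HP]]]; first by exists 0.
pose D : {poly R[i]} := \prod_(q <- s) ('X - q%:C%:P).
have DE q : root D q%:C = (q \in s).
  rewrite /D -(big_map (fun q : R => q%:C) xpredT (fun z : R[i] => 'X - z%:P)) root_prod_XsubC.
  by rewrite mem_map // => a b [].
have Dr : D.[r%:C] != 0 by rewrite -/(root _ _) DE.
exists (P + (((f r)%:C - P.[r%:C]) / D.[r%:C]) *: D) => q; rewrite inE hornerD hornerZ.
case/predU1P => [->|qs]; first by rewrite divfK // addrC subrK.
have /rootP -> : root D q%:C by rewrite DE.
by rewrite mulr0 addr0 HP.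
Qed.

Lemma pact_ext x (s : seq R) P Q y : uniq s ->
  annih x (\prod_(r <- s) ('X - r%:C%:P)) ->
  (forall r, r \in s -> P.[r%:C] = Q.[r%:C]) -> pact x P y = pact x Q y.
Proof.
move=> us H E.
have /dvdpP[D DE] : \prod_(r <- s) ('X - r%:C%:P) %| P - Q.
  rewrite -(big_map (fun q : R => q%:C) xpredT (fun z : R[i] => 'X - z%:P)).
  apply: uniq_roots_dvdp.
    apply/allP => _ /mapP[r rs ->]; apply/rootP.
    by rewrite hornerD hornerN E // subrr.
  by rewrite uniq_rootsE map_inj_uniq // => a b [].
rewrite -(subrK Q P) pactD DE pactM H.
suff -> : pact x D 0 = 0 by rewrite add0r.
by rewrite -{1}(smul0r 0) pact_right smul0r.
Qed.

End PolynomialAction.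

(** * Functional calculus, unit and projections in finite dimension *)

Section FiniteCalculus.
Context {R : realType} {A : cstarAlgType R}.
Implicit Types (a b x y z w u p : A) (f g : R -> R) (s : seq R) (Phi : (R -> R) -> A -> A).

(* Real functions of the element [x], acting on [A]: no unit is available yet. *)
Record fcalc x s Phi : Prop := FCalc {
  fc_ext : forall f g, (forall r, r \in s -> f r = g r) -> forall y, Phi f y = Phi g y;
  fc_lin : forall (a : R) f g y, Phi (fun r => a * f r + g r) y = a%:C *: Phi f y + Phi g y;
  fc_mul : forall f g y, Phi (fun r => f r * g r) y = Phi f (Phi g y);
  fc_id : forall y, Phi id y = x ** y;
  fc_one : forall y, Phi (fun=> 1) y = y;
  fc_adj : forall f, adj (Phi f) (Phi f);
  fc_right : forall f y w, Phi f (y ** w) = Phi f y ** w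
}.

(** [s] plays the role of the spectrum and [Phi f] is an interpolating polynomial; each law is an
    equality of values on [s]. *)
Lemma fcalc_exists x : finite_dimensional [set: A] -> star x = x ->
  exists s Phi, fcalc x s Phi.
Proof.
move=> [n [e he]] sx; have [s us Hs] := finite_annih sx he.
have /choice[P HP] := fun f => interpolation f us.
have ext (p q : {poly R[i]}) y : (forall r, r \in s -> p.[r%:C] = q.[r%:C]) ->
  pact x p y = pact x q y by exact: pact_ext.
exists s, (fun f => pact x (P f)); split.
- by move=> f g fg y; apply: ext => r rs; rewrite !HP // fg.
- move=> a f g y; rewrite -pactZ -pactD; apply: ext => r rs.
  by rewrite hornerD hornerZ !HP // rmorphD rmorphM.
- move=> f g y; rewrite -pactM; apply: ext => r rs.
  by rewrite hornerM !HP // rmorphM.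
- by move=> y; rewrite -pactX; apply: ext => r rs; rewrite HP // hornerX.
- move=> y; rewrite -[RHS]scale1r -(pactC x); apply: ext => r rs.
  by rewrite HP // hornerC.
- move=> f y z; rewrite pact_star //; congr (_ ** _); apply: ext => r rs.
  rewrite HP // -(conjc_real r) (horner_map (conjc : {rmorphism R[i] -> R[i]})) /=.
  by rewrite HP // conjc_real.
- by move=> f y w; exact: pact_right.
Qed.

(** Writing [f r = (f r / r) * r], valid also at 0 because [f 0 = 0], turns the map [Phi f] into
    multiplication by an element before any unit exists. *)
Lemma fc_elt x s Phi f : fcalc x s Phi -> f 0 = 0 -> exists a, forall y, Phi f y = a ** y.
Proof.
move=> H f0; exists (Phi (fun r => f r / r) x) => y.
rewrite -(fc_right H) -(fc_id H) -(fc_mul H); apply: (fc_ext H) => r _ /=.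
by have [->|r0] := eqVneq r 0; rewrite ?f0 ?mulr0 // divfK.
Qed.

Lemma smul_inj a b : (forall y, a ** y = b ** y) -> a = b.
Proof.
move=> H; apply: (can_inj (@starK R A)); apply: smul_star_inj => y.
by rewrite -!starM H.
Qed.

(** From [a ** star a <= x], conjugation by [1 - p] gives [(1 - p) a (star a) (1 - p) <= (1 - p) x
    (1 - p) = 0]. *)
Lemma support_projection x p a : p ** x = x -> star p = p ->
  nonneg (x - a ** star a) -> p ** a = a.
Proof.
move=> px sp xa.
pose W z := z - p ** z.
have bW : bop W W.
  by have := bopD (@bop_id _ A) (bopN (@bop_smul _ A p)); rewrite sp.
have LW := adj_linear bW.1.
have Wx z : W (x ** z) = 0 by rewrite /W smulA px subrr.
have pa : nonneg (a ** star a) by have := nonneg_square (star a); rewrite starK.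
have H1 := pos_conj pa bW.
have H2 : pos (fun z => - W ((a ** star a) ** W z)).
  by apply: pos_ext (pos_conj xa bW) _ => z; rewrite smulDl smulNl !LW Wx sub0r.
have H0 := pos_anti H1 H2.
have Wr y z : W (y ** z) = W y ** z by rewrite /W !expandE.
have : star (star (W a)) ** star (W a) = 0.
  apply: smul_inj => y; rewrite smul0l starK -smulA -Wr.
  by rewrite bW.1 smulA H0.
move=> E; apply/eqP; rewrite eq_sym -subr_eq0; apply/eqP; rewrite -[_ - _]/(W a).
apply: rnorm_eq0; rewrite -rnorm_star.
by apply/eqP; rewrite -sqrf_eq0 -rnorm_cstar E rnorm0.
Qed.

Definition unit_of u : Prop := (forall y, u ** y = y) /\ (forall y, y ** u = y).

(** The element [x] dominates every [e i ** star (e i)] and [star (e i) ** e i], so its support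
    projection fixes each generator on both sides. *)
Lemma finite_dim_unit : finite_dimensional [set: A] -> exists u, unit_of u.
Proof.
move=> fd; have [n [e he]] := fd.
pose x := \sum_i (e i ** star (e i) + star (e i) ** e i).
have sq a : nonneg (a ** star a) by have := nonneg_square (star a); rewrite starK.
have x_ge i : nonneg (x - (e i ** star (e i) + star (e i) ** e i)).
  rewrite /x (bigD1 i) //= [X in nonneg X]addrC addKr.
  elim/big_ind: _ => [||j _]; [exact: nonneg0 | exact: nonnegD |].
  by apply: nonnegD; [exact: sq | exact: nonneg_square].
have sx : star x = x.
  rewrite /x star_sum; apply: eq_bigr => i _; by rewrite starD !starM !starK.
have [s [Phi H]] := fcalc_exists fd sx.
pose f (r : R) : R := (r != 0)%:R.
have f0 : f 0 = 0 by rewrite /f eqxx.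
have [p Hp] := fc_elt H f0.
have sp : star p = p.
  by apply/adj_smul_sa => y z; rewrite -!Hp; exact: (fc_adj H).
have px : p ** x = x.
  apply: smul_inj => y; rewrite -Hp -(fc_right H) -(fc_id H) -(fc_mul H).
  apply: (fc_ext H) => r _; rewrite /f.
  by have [->|_] := eqVneq r 0; rewrite ?mulr0 // mul1r.
have pe i : p ** e i = e i.
  apply: (support_projection px sp); have := nonnegD (x_ge i) (nonneg_square (e i)).
  by congr nonneg; lmod; ring.
have ep i : e i ** p = e i.
  apply: (can_inj (@starK R A)); rewrite starM sp.
  apply: (support_projection px sp); rewrite starK; have := nonnegD (x_ge i) (sq (e i)).
  by congr nonneg; lmod; ring.
have rep y : exists c : 'I_n -> R[i], y = \sum_i c i *: e i.
  by have : [set: A] y by []; rewrite he => -[c _ <-]; exists c.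
exists p; split=> y; have [c ->] := rep y.
  by rewrite smul_sumr; apply: eq_bigr => i _; rewrite smulZr pe.
by rewrite smul_suml; apply: eq_bigr => i _; rewrite smulZl ep.
Qed.

Variables (u : A) (hu : unit_of u).

Lemma unit_star : star u = u.
Proof.
by have := congr1 star (hu.1 (star u)); rewrite starM starK hu.1.
Qed.

Lemma unit_rnorm : rnorm u <= 1.
Proof.
have := rnorm_sa unit_star; rewrite hu.1 expr2.
have [->|u0 H] := eqVneq (rnorm u) 0; first by rewrite ler01.
by rewrite -(ler_pM2r (_ : 0 < rnorm u)) ?mul1r -?H // lt_neqAle eq_sym u0 rnorm_ge0.
Qed.

Definition projection p : Prop := star p = p /\ p ** p = p.

Lemma proj_rnorm p : projection p -> rnorm p <= 1.
Proof.
move=> [sp pp]; have := rnorm_sa sp; rewrite pp expr2.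
have [->|u0 H] := eqVneq (rnorm p) 0; first by rewrite ler01.
by rewrite -(ler_pM2r (_ : 0 < rnorm p)) ?mul1r -?H // lt_neqAle eq_sym u0 rnorm_ge0.
Qed.

Lemma projC p : projection p -> projection (u - p).
Proof.
move=> [sp pp]; split; first by rewrite starB sp unit_star.
by rewrite !expandE !hu.1 hu.2 pp; lmod; ring.
Qed.

Section WithCalculus.
Variables (x : A) (s : seq R) (Phi : (R -> R) -> A -> A) (H : fcalc x s Phi).

Let el f := Phi f u.

Lemma el_act f y : el f ** y = Phi f y.
Proof. by rewrite /el -(fc_right H) hu.1. Qed.

Lemma el_star f : star (el f) = el f.
Proof. by apply/adj_smul_sa => y z; rewrite !el_act; exact: (fc_adj H). Qed.

Lemma el_lin (a : R) f g : el (fun r => a * f r + g r) = a%:C *: el f + el g.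
Proof. exact: (fc_lin H). Qed.

Lemma el_mul f g : el (fun r => f r * g r) = el f ** el g.
Proof. by rewrite el_act; exact: (fc_mul H). Qed.

Lemma el_id : el id = x.
Proof. by rewrite /el (fc_id H) hu.2. Qed.

Lemma el_one : el (fun=> 1) = u.
Proof. exact: (fc_one H). Qed.

Lemma el_ext f g : (forall r, r \in s -> f r = g r) -> el f = el g.
Proof. by move=> fg; exact: (fc_ext H). Qed.

Lemma el0 : el (fun=> 0) = 0.
Proof.
rewrite (@el_ext _ (fun r => -1 * 1 + 1)) => [|r _]; last by ring.
by rewrite (el_lin (-1) (fun=> 1) (fun=> 1)); lmod; ring.
Qed.

Lemma el_nonneg f : (forall r, 0 <= f r) -> nonneg (el f).
Proof.
move=> f0; pose g r := Num.sqrt (f r).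
have -> : el f = star (el g) ** el g; last exact: nonneg_square.
by rewrite el_star -el_mul; apply: el_ext => r _; rewrite /g -expr2 sqr_sqrtr.
Qed.

Lemma el_indicator (b : pred R) : projection (el (fun r => (b r)%:R)).
Proof.
split; first exact: el_star.
by rewrite -el_mul; apply: el_ext => r _; case: (b r); rewrite ?mulr1 ?mulr0.
Qed.

End WithCalculus.

(** Both elements split along [p]: the first is [2 (u-p) x (u-p) + (2x - u) p], the second
    [2 p (u-x) p + (u - 2x) (u-p)]. The calculus makes the last terms positive. *)
Lemma threshold_projection x : finite_dimensional [set: A] ->
  nonneg x -> rnorm x <= 1 -> exists p, [/\ projection p,
    nonneg ((2 : R)%:C *: x - p) & nonneg ((2 : R)%:C *: (u - x) - (u - p))].
Proof.
move=> fd x0 x1; have [s [Phi H]] := fcalc_exists fd (nonneg_sa x0).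
pose b (r : R) := 2^-1 < r; pose f r : R := (b r)%:R.
pose p := Phi f u; have [sp pp] : projection p := el_indicator H b.
have ux : nonneg (u - x).
  apply: pos_ext (sa_pos_one_sub (nonneg_sa x0) x1) _ => z.
  by rewrite smulDl smulNl hu.1.
have px : p ** x = x ** p.
  rewrite -(el_id H) -!(el_mul H); apply: (el_ext H) => r _; exact: mulrC.
exists p; split=> //.
  pose g r := (2 * r - 1) * f r.
  have g0 r : 0 <= g r.
    by rewrite /g /f /b; case: ltP => h; rewrite ?mulr0 // mulr1; lra.
  have gE : Phi g u = (2 : R)%:C *: (x ** p) - p.
    rewrite (@el_ext _ _ _ H _ (fun r => 2 * (r * f r) + (-1 * f r + 0))); last first.
      by move=> r _; rewrite /g; ring.
    rewrite (el_lin H 2 (fun r => r * f r)) (el_lin H (-1) f) (el0 H) (el_mul H) (el_id H).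
    by rewrite -/p; lmod; ring.
  have := nonnegD (nonnegZ (ler0n _ 2) (nonneg_conj (u - p) x0)) (el_nonneg H g0).
  rewrite gE starB unit_star sp; congr nonneg.
  rewrite !expandE !hu.1 !hu.2 px -smulA pp.
  by lmod; ring.
pose g r := (1 - 2 * r) * (1 - f r).
have g0 r : 0 <= g r.
  by rewrite /g /f /b; case: ltP => h; rewrite ?subrr ?mulr0 // subr0 mulr1; lra.
have gE : Phi g u = u - (2 : R)%:C *: x - p + (2 : R)%:C *: (x ** p).
  rewrite (@el_ext _ _ _ H _ (fun r => 2 * (r * f r) + (-1 * f r + (-2 * r + 1)))); last first.
    by move=> r _; rewrite /g; ring.
  rewrite (el_lin H 2 (fun r => r * f r)) (el_lin H (-1) f) (el_lin H (-2) id).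
  rewrite (el_one H) (el_mul H) (el_id H).
  by rewrite -/p; lmod; ring.
have := nonnegD (nonnegZ (ler0n _ 2) (nonneg_conj p ux)) (el_nonneg H g0).
rewrite gE sp; congr nonneg.
rewrite !expandE !hu.2 px -smulA !pp.
by lmod; ring.
Qed.

(** A self-adjoint element is the sum of its eigenvalues times spectral projections. Stated as an
    induction principle, it reduces linear identities to projections. *)
Lemma projections_span (Q : A -> Prop) : finite_dimensional [set: A] ->
  Q 0 -> (forall a b, Q a -> Q b -> Q (a + b)) ->
  (forall (c : R[i]) a, Q a -> Q (c *: a)) ->
  (forall p, projection p -> Q p) -> forall a, Q a.
Proof.
move=> fd Q0 QD QZ Qp.
have Qsa x : star x = x -> Q x.
  move=> sx; have [s [Phi H]] := fcalc_exists fd sx.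
  have key (t : seq R) : uniq t -> Q (Phi (fun r => if r \in t then r else 0) u).
    elim: t => [_|q t IH /= /andP[qt /IH Qt]]; first by rewrite (el0 H).
    rewrite (@el_ext _ _ _ H _ (fun r => q * (r == q)%:R + (if r \in t then r else 0))).
      by rewrite (el_lin H); apply: QD => //; apply: QZ; apply: Qp; exact: el_indicator H _.
    move=> r _; rewrite inE; have [->|_] := eqVneq r q.
      by rewrite (negbTE qt) mulr1 addr0.
    by rewrite mulr0 add0r.
  have := key (undup s) (undup_uniq s).
  rewrite (@el_ext _ _ _ H _ id) ?(el_id H) // => r rs.
  by rewrite mem_undup rs.
move=> a.
have -> : a = (2^-1 : R)%:C *: (a + star a) + (- 'i * (2^-1 : R)%:C) *: ('i *: (a - star a)).
  have ii : 'i * 'i = -1 :> R[i] by rewrite -expr2 sqrCi.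
  by rewrite scalerA mulrAC mulNr ii opprK; lmod; field.
apply: QD; apply: QZ; apply: Qsa.
  by rewrite starD starK addrC.
by rewrite starZi starB starK; lmod; ring.
Qed.

End FiniteCalculus.

(** * Order zero maps *)

Section OrderZero.
Context {R : realType} {F A : cstarAlgType R}.
Variables (fdF : finite_dimensional [set: F]) (u : F) (hu : unit_of u).
Variables (phi : {linear F -> A}).
Hypotheses (cp : completely_positive phi) (ct : contractive phi).

Lemma cp_proj_nonneg p : projection p -> nonneg (phi p).
Proof.
move=> [sp pp]; have [c] := cp_square p cp; rewrite sp pp => ->.
exact: nonneg_square.
Qed.

Lemma cp_star x : phi (star x) = star (phi x).
Proof.
move: x; apply: (projections_span hu (Q := fun x => phi (star x) = star (phi x))) => //.
- by rewrite star0 linear0 star0.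
- by move=> a b Ha Hb; rewrite starD !linearD starD Ha Hb.
- by move=> c a Ha; rewrite starZ !linearZ /= Ha starZ.
- by move=> p hp; rewrite hp.1 (nonneg_sa (cp_proj_nonneg hp)).
Qed.

(** The square root is only a map [S]; evaluated at the unit it becomes an element with
    [star (S u) ** S u = x]. *)
Lemma cp_nonneg x : nonneg x -> nonneg (phi x).
Proof.
move=> /pos_sqrt[S [pS SS _]].
have [c] := cp_square (S u) cp; rewrite pS.1 SS (hu.2 x) (unit_star hu) (hu.1 x) => ->.
exact: nonneg_square.
Qed.

Lemma nonneg_anti (B : cstarAlgType R) (a : B) : nonneg a -> nonneg (- a) -> a = 0.
Proof.
move=> Ha Hn; apply: smul_inj => y; rewrite smul0l; apply: (pos_anti Ha).
by apply: pos_ext Hn _ => z; rewrite smulNl.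
Qed.

Lemma nonneg_norm_unit (y : F) : nonneg ((rnorm y ^+ 2)%:C *: u - y ** star y).
Proof.
have sy : star (y ** star y) = y ** star y by rewrite starM starK.
have nE : rnorm (y ** star y) = rnorm y ^+ 2.
  by have := rnorm_cstar (star y); rewrite starK rnorm_star.
have bb : bnd (smul (y ** star y)) (rnorm y ^+ 2) by rewrite -nE; exact: bnd_smul.
apply: pos_ext (bnd_pos_sub (sqr_ge0 _) (proj2 (adj_smul_sa _) sy) bb) _ => z.
by rewrite !expandE hu.1.
Qed.

Hypothesis (oz : forall a b : F, positive a -> positive b -> a ** b = 0 -> phi a ** phi b = 0).

(** For [w = q ** y], Kadison-Schwarz gives [phi w ** star (phi w) <= phi (w ** star w) <= |y|^2 phi
    q]. Conjugation by [phi p] kills the right-hand side, since [phi p ** phi q = 0]. *)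
Lemma order_zero_orth p q y : projection p -> projection q -> p ** q = 0 ->
  phi p ** phi (q ** y) = 0.
Proof.
move=> hp hq pq; have [sp pp] := hp; have [sq qq] := hq; set w := q ** y.
have ab : phi p ** phi q = 0.
  by apply: oz => //; [exists p; rewrite sp | exists q; rewrite sq].
have H1 := kadison_schwarz (star w) cp ct; rewrite starK (cp_star w) starK in H1.
have H2 := cp_nonneg (nonneg_conj q (nonneg_norm_unit y)).
have E : star q ** ((rnorm y ^+ 2)%:C *: u - y ** star y) ** q =
    (rnorm y ^+ 2)%:C *: q - w ** star w.
  by rewrite /w starM sq smulDr smulDl smulNr smulNl smulZr smulZl hu.2 qq !smulA.
rewrite E linearB linearZ /= in H2.
have := nonneg_conj (phi p) (nonnegD H1 H2).
rewrite addrC addrA subrK.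
have sphi : star (phi p) = phi p := nonneg_sa (cp_proj_nonneg hp).
rewrite smulDr smulDl smulNr smulNl smulZr smulZl sphi ab smul0l scaler0 sub0r => Hn.
set v := phi p ** phi w.
have vE : v ** star v = phi p ** (phi w ** star (phi w)) ** phi p.
  by rewrite /v starM sphi !smulA.
rewrite -vE in Hn.
have v0 : v ** star v = 0.
  by apply: nonneg_anti => //; have := nonneg_square (star v); rewrite starK.
apply: rnorm_eq0; rewrite -rnorm_star; apply/eqP.
by rewrite -sqrf_eq0 -rnorm_cstar starK v0 rnorm0.
Qed.

Lemma order_zero_compl p y : projection p -> phi p ** phi ((u - p) ** y) = 0.
Proof.
move=> hp; apply: order_zero_orth => //; first exact: projC.
by rewrite smulDr smulNr hu.2 hp.2 subrr.
Qed.

(** For a projection [x = p] both sides reduce to [phi p ** phi (p ** y)]: split [y] on the left and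
    [u] on the right along [p] and [u - p], and the cross terms vanish by orthogonality. *)
Lemma order_zero_mul x y : phi x ** phi y = phi u ** phi (x ** y).
Proof.
move: x; pose Q x := phi x ** phi y = phi u ** phi (x ** y).
apply: (projections_span hu (Q := Q)) => //; rewrite /Q {Q}.
- by rewrite smul0l !linear0 smul0l smul0r.
- by move=> a b Ha Hb; rewrite smulDl !linearD smulDl smulDr Ha Hb.
- by move=> c a Ha; rewrite smulZl !linearZ /= smulZl smulZr Ha.
move=> p hp.
have H1 : phi y = phi (p ** y) + phi ((u - p) ** y).
  by rewrite -linearD -smulDl addrC subrK hu.1.
have H2 : phi u = phi p + phi (u - p) by rewrite -linearD addrC subrK.
have H3 := order_zero_compl y hp; have H4 := order_zero_compl y (projC hu hp).
have qp : u - (u - p) = p by lmod; ring.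
rewrite qp in H4.
by rewrite {1}H1 smulDr H3 addr0 H2 smulDl H4 addr0.
Qed.

End OrderZero.

(** * Exact normalization of an almost projection *)

Section AlmostProjection.
Context {R : realType} {A : cstarAlgType R}.
Variables (k : A) (kap : R).
Hypotheses (sk : star k = k) (k1 : rnorm k <= 1).
Hypotheses (kk : rnorm (k - k ** k) <= kap) (kap_small : kap <= 1 / 50).

(* Newton's iteration for the nonzero solution of [t g^2 = g] near [t = 1],
   damped so that it contracts to [0] near [t = 0]. *)
Definition newton (G : A) : A :=
  (2 : R)%:C *: (k ** G) - ((2 : R)%:C *: (k ** k) - k) ** (G ** G).

Lemma kap_ge0 : 0 <= kap.
Proof. exact: le_trans (rnorm_ge0 _) kk. Qed.

(** The difference factors through [2k - (2k^2 - k)(G + H)], which vanishes when [k] is a projection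
    and [G = H = k]. In general its norm is at most [22 kap + 32 kap^2], below [1/2] for
    [kap <= 1/50]. The radius [8 kap] is twice the first displacement [4 kap], as a contraction by
    [1/2] requires. *)
Lemma newton_contract G H :
  G ** k = k ** G -> H ** k = k ** H -> H ** G = G ** H ->
  rnorm (G - k) <= 8 * kap -> rnorm (H - k) <= 8 * kap ->
  rnorm (newton G - newton H) <= 2^-1 * rnorm (G - H).
Proof.
move=> Gk Hk HG G8 H8; have [w wE] : exists w, w = k - k ** k by exists (k - k ** k).
have kw : rnorm w <= kap by rewrite wE.
have Gk' y : y ** G ** k = y ** k ** G by rewrite -smulA Gk smulA.
have Hk' y : y ** H ** k = y ** k ** H by rewrite -smulA Hk smulA.
have HG' y : y ** H ** G = y ** G ** H by rewrite -smulA HG smulA.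
have [d dE] : exists d, d = (G - k) + (H - k) by exists ((G - k) + (H - k)).
have -> : newton G - newton H =
    ((2 : R)%:C *: w + ((4 : R)%:C *: (w ** k) - (k - (2 : R)%:C *: w) ** d)) ** (G - H).
  by rewrite /newton dE wE !expandE; rewrite ?(Gk', Hk', HG', Gk, Hk, HG); lmod; ring.
apply: le_trans (rnormM _ _) _; apply: ler_wpM2r; first exact: rnorm_ge0.
have d16 : rnorm d <= 16 * kap by rewrite dE; apply: le_trans (rnormD _ _) _; lra.
have w0 := rnorm_ge0 w; have d0 := rnorm_ge0 d; have kp := kap_ge0.
have b1 : rnorm (k - (2 : R)%:C *: w) <= 1 + 2 * kap.
  by apply: le_trans (rnormB _ _) _; rewrite rnormZ ger0_norm // lerD // ler_pM2l.
have b2 : rnorm ((k - (2 : R)%:C *: w) ** d) <= (1 + 2 * kap) * (16 * kap).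
  by apply: le_trans (rnormM _ _) _; apply: ler_pM => //; exact: rnorm_ge0.
have b3 : rnorm (w ** k) <= kap.
  by apply: le_trans (rnormM _ _) (le_trans _ kw); rewrite ler_piMr.
apply: le_trans (rnormD _ _) _.
have := rnormB ((4 : R)%:C *: (w ** k)) ((k - (2 : R)%:C *: w) ** d).
rewrite !rnormZ !ger0_norm // => b4.
have k2 : kap * kap <= kap * (1 / 50) by exact: ler_wpM2l.
nra.
Qed.

Lemma newton_start : rnorm (newton k - k) <= 4 * kap.
Proof.
have [w wE] : exists w, w = k - k ** k by exists (k - k ** k).
have kw : rnorm w <= kap by rewrite wE.
have -> : newton k - k = w ** k + ((2 : R)%:C *: (w ** k ** k) - w).
  by rewrite /newton wE !expandE; lmod; ring.
have k0 := rnorm_ge0 k; have w0 := rnorm_ge0 w.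
have b1 : rnorm (w ** k) <= kap.
  by apply: le_trans (rnormM _ _) (le_trans _ kw); rewrite ler_piMr.
have b2 : rnorm (w ** k ** k) <= kap.
  by apply: le_trans (rnormM _ _) (le_trans _ b1); rewrite ler_piMr // rnorm_ge0.
apply: le_trans (rnormD _ _) _; have := rnormB ((2 : R)%:C *: (w ** k ** k)) w.
rewrite rnormZ ger0_norm //; lra.
Qed.

(** A fixed point satisfies [(2k - 1) v = 0] for [v = k G^2 - G]. Then [k v = v / 2], so
    [(k - k^2) v = v / 4], which the smallness of [k - k^2] excludes unless [v = 0]. *)
Lemma newton_fixed G : G ** k = k ** G -> newton G = G -> k ** (G ** G) = G.
Proof.
move=> Gk E; have kp := kap_ge0; have [w wE] : exists w, w = k - k ** k by exists (k - k ** k).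
have kw : rnorm w <= kap by rewrite wE.
have [v vE] : exists v, v = k ** (G ** G) - G by exists (k ** (G ** G) - G).
have v2 : (2 : R)%:C *: (k ** v) = v.
  have -> : (2 : R)%:C *: (k ** v) = v + (G - newton G).
    by rewrite vE /newton !expandE; lmod; ring.
  by rewrite E subrr addr0.
have v4 : v = (4 : R)%:C *: (w ** v).
  have -> : w ** v = k ** v - k ** (k ** v) by rewrite wE !expandE.
  have {2}-> : k ** v = 2^-1%:C *: v by rewrite -{2}v2; lmod; field.
  have -> : k ** v = 2^-1%:C *: v by rewrite -{2}v2; lmod; field.
  rewrite smulZr; have -> : k ** v = 2^-1%:C *: v by rewrite -{2}v2; lmod; field.
  by lmod; field.
have : rnorm v <= 4 * (kap * rnorm v).
  rewrite {1}v4 rnormZ ger0_norm // ler_wpM2l //.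
  by apply: le_trans (rnormM _ _) _; rewrite ler_wpM2r ?rnorm_ge0.
have := rnorm_ge0 v => v0 Hv.
have kv : kap * rnorm v <= 1 / 50 * rnorm v by exact: ler_wpM2r.
have /rnorm_eq0 /eqP : rnorm v = 0 by apply/eqP; rewrite eq_le v0 andbT; lra.
by rewrite vE subr_eq0 => /eqP.
Qed.

Fixpoint newton_iter n : A := if n is m.+1 then newton (newton_iter m) else k.

(** Partial sums of [4 kap + 2 kap + kap + ...], the majorant for the iteration. *)
Fixpoint newton_bound n : R :=
  if n is m.+1 then 2^-1 * (newton_bound m + 8 * kap) else 0.

Lemma almost_projection : exists G : A,
  [/\ star G = G, k ** (G ** G) = G, rnorm (G - k ** k) <= 9 * kap &
      forall b, b ** k = k ** b -> b ** G = G ** b].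
Proof.
have kp := kap_ge0.
have Gc n b : b ** k = k ** b -> b ** newton_iter n = newton_iter n ** b.
  move=> bk; elim: n => [|n IH] //=; rewrite -/(newton_iter n).
  have bk' y : y ** b ** k = y ** k ** b by rewrite -smulA bk smulA.
  have IH' y : y ** b ** newton_iter n = y ** newton_iter n ** b by rewrite -smulA IH smulA.
  by rewrite /newton !expandE ?(bk, bk', IH, IH').
have Gk n : newton_iter n ** k = k ** newton_iter n by rewrite Gc.
have Gs n : star (newton_iter n) = newton_iter n.
  elim: n => [|n IH] //=; rewrite /newton !expandE IH !sk.
  have Gk' y : y ** newton_iter n ** k = y ** k ** newton_iter n by rewrite -smulA Gk smulA.
  by rewrite ?(Gk, Gk').
have G8 n : rnorm (newton_iter n - k) <= 8 * kap.
  elim: n => [|n IH] /=; first by rewrite subrr rnorm0; lra.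
  have H := newton_contract (Gk n) (erefl _) (esym (Gk n)) IH _.
  have -> : newton (newton_iter n) - k =
        (newton (newton_iter n) - newton k) + (newton k - k) by lmod; ring.
  apply: le_trans (rnormD _ _) _; have := newton_start.
  by have := H _; rewrite subrr rnorm0 mulr_ge0 // => /(_ erefl); lra.
have v8 n : newton_bound n <= 8 * kap by elim: n => [|n IH] /=; lra.
have Gd m n : (m <= n)%N ->
    rnorm (newton_iter n - newton_iter m) <= newton_bound n - newton_bound m.
  elim: n m => [|n IH] [|m] // mn; rewrite ?subrr ?rnorm0 //.
    have := IH 0%N isT; rewrite /= !subr0 => {}IH.
    have -> : newton (newton_iter n) - k =
        (newton (newton_iter n) - newton k) + (newton k - k) by lmod; ring.
    apply: le_trans (rnormD _ _) _; have := newton_start.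
    have k8 : rnorm (k - k) <= 8 * kap by rewrite subrr rnorm0 mulr_ge0.
    have := newton_contract (Gk n) (erefl _) (esym (Gk n)) (G8 n) k8; lra.
  have := newton_contract (Gk n) (Gk m) (Gc n _ (Gk m)) (G8 n) (G8 m).
  by have := IH m mn => /=; lra.
have [L HL] := complete_dominated Gd v8.
have Lc b : b ** k = k ** b -> b ** L = L ** b.
  move=> bk; apply: (@tends_unique _ _ (fun n => b ** newton_iter n)).
    apply: (tends_lip (f := smul b) (M := rnorm b)) HL => x y.
    by rewrite -smulNr -smulDr; exact: rnormM.
  under [X in tends X]eq_fun do rewrite (Gc _ _ bk).
  apply: (tends_lip (f := fun x => x ** b) (M := rnorm b)) HL => x y.
  by rewrite -smulNl -smulDl mulrC; exact: rnormM.
have Lk : L ** k = k ** L by rewrite Lc.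
have Ls : star L = L.
  apply: tends_unique (HL); rewrite -(funext Gs).
  apply: (tends_lip (f := @star R A) (M := 1)) HL => x y.
  by rewrite -starB rnorm_star mul1r.
have L8 : rnorm (L - k) <= 8 * kap.
  apply: (@tends_rnorm_le _ _ (fun n => newton_iter n - k) _ _ _ G8).
  apply: (tends_lip (f := fun x => x - k) (M := 1)) HL => x y.
  by rewrite mul1r (_ : x - k - (y - k) = x - y) //; lmod; ring.
have LE : newton L = L.
  apply: tends_unique (tends_shift HL) => e e0.
  have [N HN] := HL e e0; exists N => n /HN Hn.
  have := newton_contract (Gk n) Lk (esym (Lc _ (Gk n))) (G8 n) L8.
  rewrite -/(newton_iter n.+1) /=; have := rnorm_ge0 (newton_iter n - L); lra.
exists L; split => //.
  exact: newton_fixed.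
(* The comparison is with [k^2] rather than [k] because compressing [g y] by [k] produces the factor
   [k^2]. *)
have -> : L - k ** k = (L - k) + (k - k ** k) by lmod; ring.
apply: le_trans (rnormD _ _) _.
by rewrite (_ : 9 * kap = 8 * kap + kap) ?lerD //; ring.
Qed.

End AlmostProjection.

(** * Finite-dimensional subspaces are closed *)

Section FiniteDimClosed.
Context {R : realType} {A : cstarAlgType R}.

Lemma real_cauchy_lim (c : nat -> R) :
  (forall e : R, 0 < e -> exists N : nat, forall m n, (N <= m)%N -> (N <= n)%N ->
     `|c m - c n| <= e) ->
  exists l : R, forall e : R, 0 < e -> exists N : nat, forall n, (N <= n)%N -> `|c n - l| <= e.
Proof.
move=> H.
have hc : cauchy (c @ \oo).
  apply: cauchy_exP => e e0; have e2 : 0 < e / 2 by lra.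
  have [N HN] := H _ e2; exists (c N), N => // n /= Nn.
  rewrite -ball_normE /=; apply: le_lt_trans (HN N n (leqnn N) Nn) _; lra.
have hl : cvg (c @ \oo) by exact: (@cauchy_cvg R _ _ hc).
move/cvg_ex: hl => [l Hl]; exists l => e e0.
have /cvgrPdist_le /(_ _ e0) [N _ HN] := Hl.
by exists N => n /HN /=; rewrite distrC.
Qed.

Definition cmod (c : R[i]) : R := complex.Re `|c|.

Lemma cmod_ge0 c : 0 <= cmod c.
Proof. by rewrite /cmod normc_def /= sqrtr_ge0. Qed.

Lemma cmod_Re c : `|complex.Re c| <= cmod c.
Proof.
rewrite /cmod normc_def /= -sqrtr_sqr ler_wsqrtr // lerDl; exact: sqr_ge0.
Qed.

Lemma cmod_Im c : `|complex.Im c| <= cmod c.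
Proof.
rewrite /cmod normc_def /= -sqrtr_sqr ler_wsqrtr // lerDr; exact: sqr_ge0.
Qed.

Lemma cmod_le c : cmod c <= `|complex.Re c| + `|complex.Im c|.
Proof.
rewrite /cmod normc_def /= -[leRHS]ger0_norm ?addr_ge0 // -sqrtr_sqr ler_wsqrtr //.
case: c => a b /=; rewrite -(real_normK (num_real a)) -(real_normK (num_real b)).
by have := normr_ge0 a; have := normr_ge0 b; nra.
Qed.

Lemma complex_cauchy_lim (c : nat -> R[i]) :
  (forall e : R, 0 < e -> exists N : nat, forall m n, (N <= m)%N -> (N <= n)%N ->
     cmod (c m - c n) <= e) ->
  exists l : R[i], forall e : R, 0 < e ->
    exists N : nat, forall n, (N <= n)%N -> cmod (c n - l) <= e.
Proof.
move=> H.
have [a Ha] : exists a, forall e, 0 < e -> exists N : nat, forall n, (N <= n)%N ->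
    `|complex.Re (c n) - a| <= e.
  apply: real_cauchy_lim => e e0; have [N HN] := H e e0; exists N => m n Nm Nn.
  apply: le_trans (HN m n Nm Nn); apply: le_trans (cmod_Re _).
  by case: (c m) (c n) => [? ?] [? ?].
have [b Hb] : exists b, forall e, 0 < e -> exists N : nat, forall n, (N <= n)%N ->
    `|complex.Im (c n) - b| <= e.
  apply: real_cauchy_lim => e e0; have [N HN] := H e e0; exists N => m n Nm Nn.
  apply: le_trans (HN m n Nm Nn); apply: le_trans (cmod_Im _).
  by case: (c m) (c n) => [? ?] [? ?].
exists (a +i* b) => e e0; have e2 : 0 < e / 2 by lra.
have [N HN] := Ha _ e2; have [M HM] := Hb _ e2.
exists (maxn N M) => n; rewrite geq_max => /andP[/HN Hn /HM Hm].
apply: le_trans (cmod_le _) _; move: Hn Hm; case: (c n) => x y /=; lra.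
Qed.

Lemma small_inv (eps : R) : 0 < eps ->
  exists N : nat, forall n, (N <= n)%N -> n.+1%:R^-1 <= eps.
Proof.
move=> e0; exists (Num.truncn eps^-1) => n Nn.
rewrite -[leRHS]invrK lef_pV2 ?posrE ?invr_gt0 ?ltr0n //.
apply/ltW/(lt_le_trans (real_truncnS_gt (num_real _))).
by rewrite ler_nat.
Qed.

(** Indexed by [nat], so that the induction on [n] keeps one family [e]. *)
Definition lspan n (e : nat -> A) (a : A) : Prop :=
  exists c : nat -> R[i], a = \sum_(i < n) c i *: e i.

Lemma lspanD n e a b : lspan n e a -> lspan n e b -> lspan n e (a + b).
Proof.
move=> [c ->] [d ->]; exists (fun i => c i + d i); rewrite -big_split /=.
by apply: eq_bigr => i _; rewrite scalerDl.
Qed.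

Lemma lspanZ n e (t : R[i]) a : lspan n e a -> lspan n e (t *: a).
Proof.
move=> [c ->]; exists (fun i => t * c i); rewrite scaler_sumr.
by apply: eq_bigr => i _; rewrite scalerA.
Qed.

Lemma lspanS n e a (t : R[i]) : lspan n e a -> lspan n.+1 e (a + t *: e n).
Proof.
move=> [c ->]; exists (fun i => if i == n then t else c i); rewrite big_ord_recr /= eqxx.
by congr (_ + _); apply: eq_bigr => i _; rewrite ltn_eqF.
Qed.

Lemma lspan_closed n e a :
  (forall eps : R, 0 < eps -> exists2 b, lspan n e b & rnorm (a - b) <= eps) ->
  lspan n e a.
Proof.
elim: n a => [|n IH] a H.
  exists (fun=> 0); rewrite big_ord0; apply: rnorm_small_eq0 => eps /H[b [c ->]].
  by rewrite big_ord0 subr0.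
have split_span b : lspan n.+1 e b -> exists2 b', lspan n e b' & exists t, b = b' + t *: e n.
  move=> [c ->]; rewrite big_ord_recr /=; exists (\sum_(i < n) c i *: e i); first by exists c.
  by exists (c n).
have [[d d0 Hd]|Hn] := pselect (exists2 d : R, 0 < d &
    forall b, lspan n e b -> d <= rnorm (e n - b)); last first.
  have en : lspan n e (e n).
    apply: IH => eps e0; apply: contrapT => Hc; apply: Hn; exists eps => // b hb.
    by rewrite leNgt; apply/negP => hlt; apply: Hc; exists b => //; exact: ltW.
  have Ha : lspan n e a.
    apply: IH => eps /H[b /split_span[b' hb' [t ->]] hab].
    by exists (b' + t *: e n) => //; apply: lspanD => //; exact: lspanZ.
  by have := lspanS 0 Ha; rewrite scale0r addr0.
have Hk (k : nat) : exists bt : A * R[i], lspan n e bt.1 /\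
    rnorm (a - (bt.1 + bt.2 *: e n)) <= k.+1%:R^-1.
  have k0 : 0 < k.+1%:R^-1 :> R by rewrite invr_gt0 ltr0n.
  by have [_ /split_span[b' hb' [t ->]] hab] := H _ k0; exists (b', t).
have /choice[bt Hbt] := Hk.
have cauchy_t : forall eps : R, 0 < eps -> exists N : nat, forall m k,
    (N <= m)%N -> (N <= k)%N -> cmod ((bt m).2 - (bt k).2) <= eps.
  move=> eps e0; have ed : 0 < eps * d / 2 by rewrite divr_gt0 ?mulr_gt0.
  have [N HN] := small_inv ed; exists N => m k /HN Nm /HN Nk.
  have [hm am] := Hbt m; have [hk ak] := Hbt k.
  set t := (bt m).2 - (bt k).2.
  have [t0|t0] := eqVneq t 0; first by rewrite t0 /cmod normr0 /= ltW.
  pose v := - t^-1 *: ((bt m).1 - (bt k).1).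
  have hv : lspan n e v.
    by apply: lspanZ; apply: lspanD => //; rewrite -scaleN1r; exact: lspanZ.
  have tv : t *: (e n - v) =
     (a - ((bt k).1 + (bt k).2 *: e n)) - (a - ((bt m).1 + (bt m).2 *: e n)).
    have -> : t *: (e n - v) = t *: e n + ((bt m).1 - (bt k).1).
      by rewrite /v scalerBr scalerA mulrN mulfV // scaleN1r opprK.
    by rewrite /t scalerBl; lmod; ring.
  have : cmod t * rnorm (e n - v) <= eps * d.
    rewrite /cmod -rnormZc tv; apply: le_trans (rnormB _ _) _.
    by rewrite [leRHS]splitr; apply: lerD; [exact: le_trans ak Nk | exact: le_trans am Nm].
  have := Hd _ hv; have := cmod_ge0 t => c0 dv Hc.
  rewrite -(ler_pM2r d0); apply: le_trans Hc; exact: ler_wpM2l.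
have [t Ht] := complex_cauchy_lim cauchy_t.
have Ha : lspan n e (a - t *: e n).
  apply: IH => eps e0; have e2 : 0 < eps / 2 by lra.
  have r0 := rnorm_ge0 (e n).
  have e3 : 0 < eps / 2 / (rnorm (e n) + 1) by rewrite divr_gt0 // ltr_wpDl.
  have [N HN] := small_inv e2; have [M HM] := Ht _ e3.
  pose k := maxn N M; have Nk := HN k (leq_maxl _ _); have Mk := HM k (leq_maxr _ _).
  have [hk ak] := Hbt k; exists (bt k).1 => //.
  have -> : a - t *: e n - (bt k).1 =
     (a - ((bt k).1 + (bt k).2 *: e n)) + ((bt k).2 - t) *: e n.
    by rewrite scalerBl; lmod; ring.
  apply: le_trans (rnormD _ _) _; rewrite rnormZc -/(cmod _).
  have H1 : cmod ((bt k).2 - t) * (rnorm (e n) + 1) <= eps / 2.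
    by rewrite -ler_pdivlMr // ltr_wpDl.
  rewrite [leRHS]splitr; apply: lerD; first exact: le_trans ak Nk.
  by apply: le_trans H1; rewrite mulrDr mulr1 lerDl cmod_ge0.
by have := lspanS t Ha; rewrite subrK.
Qed.

Lemma finite_dimensional_closed (V : set A) : finite_dimensional V -> closed V.
Proof.
move=> [n [e ->]] a Ha.
pose e' i : A := if insub i is Some j then e j else 0.
have eE (c : nat -> R[i]) : \sum_(i < n) c i *: e' i = \sum_(i < n) c i *: e i.
  by apply: eq_bigr => i _; rewrite /e' valK.
suff [c ->] : lspan n e' a by rewrite (eE c); exists (fun i => c i).
apply: lspan_closed => eps e0.
have ec : 0 < eps%:C :> R[i] by rewrite ltcR.
have [b [[c _ <-] hb]] := Ha _ (nbhsx_ballx a _ ec).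
exists (\sum_i c i *: e i).
  pose c' i : R[i] := if insub i is Some j then c j else 0.
  by exists c'; rewrite (eE c'); apply: eq_bigr => i _; rewrite /c' valK.
by move: hb; rewrite -ball_normE /= rnormE ltcR => /ltW.
Qed.

End FiniteDimClosed.

(** * Approximation by a corner *)

Section Corner.
Context {R : realType} {F A : cstarAlgType R}.
Variables (fdF : finite_dimensional [set: F]) (u : F) (hu : unit_of u).
Variables (phi : {linear F -> A}).
Hypotheses (cp : completely_positive phi) (ct : contractive phi).
Hypothesis (oz : forall a b : F, positive a -> positive b -> a ** b = 0 -> phi a ** phi b = 0).
Variables (x p : F) (hp : projection p).
Hypotheses (px : nonneg ((2 : R)%:C *: x - p))
  (qx : nonneg ((2 : R)%:C *: (u - x) - (u - p))).

Variables (h k : A) (hE : h = phi u) (kE : k = phi p).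
Let V z := z - h ** z.

Let mulE y z : phi y ** phi z = h ** phi (y ** z).
Proof. by rewrite hE; exact: (order_zero_mul fdF hu cp ct oz). Qed.

Let posE y : nonneg y -> nonneg (phi y).
Proof. exact: (cp_nonneg hu cp). Qed.

Lemma corner_sa : star k = k.
Proof. by rewrite kE; exact: nonneg_sa (cp_proj_nonneg cp hp). Qed.

Lemma corner_rnorm : rnorm k <= 1.
Proof. by rewrite kE; exact: le_trans (contractive_rnorm _ ct) (proj_rnorm hp). Qed.

Let h_nonneg : nonneg h.
Proof. by rewrite hE; apply: posE; have := nonneg_square u; rewrite (unit_star hu) hu.1. Qed.

Let h1 : rnorm h <= 1.
Proof. by rewrite hE; exact: le_trans (contractive_rnorm _ ct) (unit_rnorm hu). Qed.

Let V_pos : pos V.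
Proof. exact: sa_pos_one_sub (nonneg_sa h_nonneg) h1. Qed.

Let V_bnd : bnd V 1.
Proof. exact: nonneg_one_sub_bnd. Qed.

Let hk : h ** k = k ** k.
Proof. by rewrite kE mulE hp.2. Qed.

Let kh : k ** h = k ** k.
Proof. by rewrite kE hE !mulE hp.2 hu.2. Qed.

(** Adding [1 - h >= 0] to the image of [qx] gives [1 - k <= 2 (1 - phi x)]; [pos_contr_rnorm] then
    bounds [(1 - k) a]. *)
Lemma corner_approx (a : A) :
  rnorm (a - k ** a) ^+ 2 <= 2 * rnorm (star a ** (a - phi x ** a)).
Proof.
have kn : nonneg k by rewrite kE; exact: cp_proj_nonneg.
have W : pos (fun z => (2 : R)%:C *: (z - phi x ** z) - (z - k ** z)).
  apply: pos_ext (posD V_pos (posE qx)) _ => z.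
  have -> : phi ((2 : R)%:C *: (u - x) - (u - p)) = (2 : R)%:C *: (h - phi x) - (h - k).
    rewrite hE kE [phi (_ - _)]linearB [phi (_ *: _)]linearZ /=.
    by rewrite [phi (u - x)]linearB [phi (u - p)]linearB.
  by rewrite /V !expandE; lmod; ring.
have kp := sa_pos_one_sub corner_sa corner_rnorm.
apply: le_trans (pos_contr_rnorm a kp (nonneg_one_sub_bnd kn corner_rnorm)) _.
have -> : 2 * rnorm (star a ** (a - phi x ** a)) =
    rnorm (star a ** ((2 : R)%:C *: (a - phi x ** a))).
  by rewrite smulZr rnormZ ger0_norm.
apply: nonneg_rnorm_le; first exact: (nonneg_op a kp).
by have := nonneg_op a W; rewrite smulDr smulNr.
Qed.

(** As [h k = k h = k^2], [k - k^2] equals [V k] and [k V] for [V = 1 - h]. Its square is [w k] with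
    [w = V k V <= 2 V (phi x) V], which is small where [h] almost fixes [phi x]. *)
Lemma corner_almost_idem :
  rnorm (k - k ** k) ^+ 2 <= 2 * rnorm (phi x - h ** phi x).
Proof.
pose w := k - h ** k - k ** h + h ** k ** h.
have LV := adj_linear V_pos.1.
have xh : phi x ** h = h ** phi x by rewrite hE !mulE hu.1 hu.2.
have hs := nonneg_sa h_nonneg.
have wE z : w ** z = V (k ** V z) by rewrite /w /V !expandE; lmod; ring.
have wn : rnorm w <= 2 * rnorm (phi x - h ** phi x).
  have bV := pos_bop V_pos.
  apply: (@nonneg_bnd_le _ _ _ (fun z => (2 : R)%:C *: V (phi x ** V z))).
  - by apply: pos_ext (pos_conj (cp_proj_nonneg cp hp) bV) _ => z; rewrite wE -kE.
  - apply: pos_ext (pos_conj (posE px) bV) _ => z.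
    have -> : phi ((2 : R)%:C *: x - p) = (2 : R)%:C *: phi x - k.
      by rewrite linearB linearZ kE.
    by rewrite wE smulDl smulNl smulZl !LV.
  - by rewrite mulr_ge0 // rnorm_ge0.
  - have b1 : bnd (fun z => phi x ** V z) (rnorm (phi x - h ** phi x)).
      move=> z; have -> : phi x ** V z = (phi x - h ** phi x) ** z.
        by rewrite /V -xh !expandE.
      exact: rnormM.
    have := bndZ (2 : R) (bnd_comp ler01 V_bnd b1).
    by rewrite mul1r ger0_norm.
set v := k - k ** k; have vs : star v = v by rewrite /v !expandE corner_sa.
have vv : v ** v = w ** k.
  have kh' y : y ** k ** h = y ** k ** k by rewrite -smulA kh smulA.
  by rewrite /v /w !expandE ?(hk, kh, kh'); lmod; ring.
rewrite -rnorm_sa // vv; apply: le_trans (rnormM _ _) (le_trans _ wn).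
by rewrite ler_piMr ?rnorm_ge0 // corner_rnorm.
Qed.

(** Since [x2 <= u], [1 - h <= 1 - phi x2], and [phi x2] is close to [e2], which almost fixes [e].
    So [|V e|^2 <= 2 s^4], and replacing [e] by [phi x] costs one more [s^4 <= s^2]. *)
Lemma corner_unit_bound (x2 : F) (e e2 : A) (s : R) :
  0 <= s -> s <= 1 -> star x2 = x2 -> rnorm x2 <= 1 -> rnorm e <= 1 ->
  rnorm (phi x - e) <= s ^+ 4 -> rnorm (phi x2 - e2) <= s ^+ 4 ->
  rnorm (e - e2 ** e) <= s ^+ 4 -> rnorm (phi x - h ** phi x) <= 3 * s ^+ 2.
Proof.
move=> s0 s1 sx2 x21 e1 H1 H2 H3.
have LV := adj_linear V_pos.1.
have b1 : rnorm (V (phi x - e)) <= s ^+ 4.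
  by apply: le_trans (V_bnd _) _; rewrite mul1r.
have b2 : rnorm (e - phi x2 ** e) <= 2 * s ^+ 4.
  have -> : e - phi x2 ** e = (e - e2 ** e) - (phi x2 - e2) ** e.
    by rewrite !expandE; lmod; ring.
  apply: le_trans (rnormB _ _) _; rewrite mulrDl mul1r lerD //.
  apply: le_trans (rnormM _ _) (le_trans _ H2).
  by rewrite ler_piMr ?rnorm_ge0.
have b3 : rnorm (V e) ^+ 2 <= 2 * s ^+ 4.
  apply: le_trans (pos_contr_rnorm e V_pos V_bnd) _.
  apply: le_trans b2; apply: (@le_trans _ _ (rnorm (star e ** (e - phi x2 ** e)))).
    apply: nonneg_rnorm_le; first exact: (nonneg_op e V_pos).
    have ux2 : nonneg (u - x2).
      by apply: pos_ext (sa_pos_one_sub sx2 x21) _ => z; rewrite smulDl smulNl hu.1.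
    have := nonneg_conj e (posE ux2); congr nonneg.
    have -> : phi (u - x2) = h - phi x2 by rewrite linearB hE.
    by rewrite /V !expandE; lmod; ring.
  by apply: le_trans (rnormM _ _) _; rewrite rnorm_star ler_piMl ?rnorm_ge0.
have b4 : rnorm (V e) <= 2 * s ^+ 2.
  rewrite -ler_sqr ?nnegrE ?rnorm_ge0 ?mulr_ge0 ?sqr_ge0 //.
  apply: le_trans b3 _; rewrite exprMn -exprM ler_wpM2r ?exprn_ge0 //.
  by rewrite expr2; lra.
have -> : phi x - h ** phi x = V (phi x - e) + V e by rewrite /V !expandE; lmod; ring.
apply: le_trans (rnormD _ _) _.
have s42 : s ^+ 4 <= s ^+ 2 by rewrite ler_wiXn2l.
lra.
Qed.

Section CornerAlgebra.
Variables (G : A) (Gs : star G = G) (GG : k ** (G ** G) = G)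
  (Gc : forall b, b ** k = k ** b -> b ** G = G ** b).

Let cut (y : F) : F := p ** y ** p.

Definition corner_alg : set A := [set G ** phi (cut y) | y in [set: F]].

Let pcut y : p ** cut y = cut y.
Proof. by rewrite /cut !smulA hp.2. Qed.

Let cutp y : cut y ** p = cut y.
Proof. by rewrite /cut -!smulA hp.2. Qed.

Let k_cut y : k ** phi (cut y) = h ** phi (cut y).
Proof. by rewrite kE mulE pcut. Qed.

Let cut_k y : phi (cut y) ** k = h ** phi (cut y).
Proof. by rewrite kE mulE cutp. Qed.

Let G_cut y : phi (cut y) ** G = G ** phi (cut y).
Proof. by apply: Gc; rewrite k_cut cut_k. Qed.

(** [G] commutes with the corner, where [h] acts as [k]; the product is [G^2 h] times an image from
    the corner, and [k G^2 = G] restores the form. *)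
Lemma corner_alg_mul y z :
  G ** phi (cut y) ** (G ** phi (cut z)) = G ** phi (cut (y ** p ** z)).
Proof.
have E : cut y ** cut z = cut (y ** p ** z).
  by rewrite /cut -!smulA [p ** (p ** _)]smulA hp.2.
have Gk : k ** G = G ** k by rewrite Gc.
rewrite -[in RHS]GG -[_ ** _ ** (G ** _)]smulA [phi _ ** (G ** _)]smulA G_cut.
rewrite -[G ** _ ** phi (cut z)]smulA mulE E -k_cut !smulA.
by rewrite Gk -[_ ** k ** G]smulA Gk !smulA.
Qed.

Lemma corner_alg_star y : star (G ** phi (cut y)) = G ** phi (cut (star y)).
Proof.
rewrite starM Gs -(cp_star fdF hu cp) -G_cut; congr (phi _ ** _).
by rewrite /cut !starM hp.1 smulA.
Qed.

Lemma corner_alg_finite : finite_dimensional corner_alg.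
Proof.
have [n [e he]] := fdF; exists n, (fun i => G ** phi (cut (e i))).
have E c : G ** phi (cut (\sum_(i < n) c i *: e i)) =
    \sum_(i < n) c i *: (G ** phi (cut (e i))).
  rewrite /cut smul_sumr smul_suml linear_sum smul_sumr; apply: eq_bigr => i _.
  by rewrite smulZr smulZl linearZ smulZr.
apply/seteqP; split => a.
  move=> [y _ <-]; have : [set: F] y by [].
  by rewrite he => -[c _ <-]; exists c.
by move=> [c _ <-]; exists (\sum_(i < n) c i *: e i).
Qed.

Lemma corner_alg_sub : cstar_subalgebra corner_alg.
Proof.
have cutD y z : cut (y + z) = cut y + cut z by rewrite /cut smulDr smulDl.
have cutZ (c : R[i]) y : cut (c *: y) = c *: cut y by rewrite /cut smulZr smulZl.
split.
- by exists 0 => //; rewrite /cut smul0r smul0l linear0 smul0r.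
- move=> _ _ [y _ <-] [z _ <-]; exists (y + z) => //.
  by rewrite cutD linearD smulDr.
- move=> c _ [y _ <-]; exists (c *: y) => //.
  by rewrite cutZ linearZ smulZr.
- move=> _ _ [y _ <-] [z _ <-]; exists (y ** p ** z) => //.
  by rewrite corner_alg_mul.
- move=> _ [y _ <-]; exists (star y) => //.
  by rewrite corner_alg_star.
exact: finite_dimensional_closed corner_alg_finite.
Qed.

Lemma corner_compress y : k ** phi y ** k = k ** k ** phi (cut y).
Proof.
rewrite -[k ** k ** _]smulA k_cut smulA kh -hk -[h ** k ** _]smulA k_cut.
by rewrite kE mulE -smulA mulE.
Qed.

Lemma corner_dist (a : A) (y : F) (M s : R) :
  1 <= M -> 0 <= s -> s <= 1 -> rnorm a <= M -> rnorm y <= M ->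
  rnorm (a - phi y) <= s ^+ 4 ->
  rnorm (a - k ** a) <= 2 * M * s ^+ 2 -> rnorm (star a - k ** star a) <= 2 * M * s ^+ 2 ->
  rnorm (G - k ** k) <= 27 * s ->
  exists2 b, corner_alg b & rnorm (a - b) <= 32 * M * s.
Proof.
move=> M1 s0 s1 aM yM ay ka ka' Gk; exists (G ** phi (cut y)); first by exists y.
have ak : rnorm (a - a ** k) <= 2 * M * s ^+ 2.
  by rewrite -rnorm_star starB starM corner_sa.
(* The four terms are at most [2 M s^2], [2 M s^2], [s^4] and [27 s M]; with [M >= 1] and [s <= 1]
   they add up to at most [32 M s]. *)
have -> : a - G ** phi (cut y) = (a - k ** a) + (k ** (a - a ** k) +
    (k ** (a - phi y) ** k - (G - k ** k) ** phi (cut y))).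
  by rewrite !expandE corner_compress; lmod; ring.
have k0 := rnorm_ge0 k; have k1 := corner_rnorm.
have b1 : rnorm (k ** (a - a ** k)) <= 2 * M * s ^+ 2.
  by apply: le_trans (rnormM _ _) (le_trans _ ak); rewrite ler_piMl ?rnorm_ge0.
have b2 : rnorm (k ** (a - phi y) ** k) <= s ^+ 4.
  apply: le_trans (rnormM _ _) (le_trans _ ay).
  apply: le_trans (_ : rnorm (k ** (a - phi y)) <= _).
    by rewrite ler_piMr ?rnorm_ge0.
  by apply: le_trans (rnormM _ _) _; rewrite ler_piMl ?rnorm_ge0.
have b3 : rnorm (phi (cut y)) <= M.
  apply: le_trans (contractive_rnorm _ ct) (le_trans _ yM).
  apply: le_trans (rnormM _ _) _.
  apply: le_trans (_ : rnorm (p ** y) <= _).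
    by rewrite ler_piMr ?rnorm_ge0 ?proj_rnorm.
  by apply: le_trans (rnormM _ _) _; rewrite ler_piMl ?rnorm_ge0 ?proj_rnorm.
have b4 : rnorm ((G - k ** k) ** phi (cut y)) <= 27 * s * M.
  by apply: le_trans (rnormM _ _) _; apply: ler_pM; rewrite ?rnorm_ge0.
have s2 : s ^+ 2 <= s by rewrite ler_iXnr.
have s4 : s ^+ 4 <= s by rewrite ler_iXnr.
apply: le_trans (rnormD _ _) _.
have := rnormD (k ** (a - a ** k)) (k ** (a - phi y) ** k - (G - k ** k) ** phi (cut y)).
have := rnormB (k ** (a - phi y) ** k) ((G - k ** k) ** phi (cut y)).
nra.
Qed.

End CornerAlgebra.

End Corner.

(** * Selection of one component and final estimate *)

Lemma convex_component (R : realType) (A : cstarAlgType R) n (t : 'I_n -> R)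
    (T : 'I_n -> {linear A -> A}) (f : A -> A) (i : 'I_n) (b : A) (delta : R) :
  (forall j, completely_positive (T j) /\ contractive (T j)) ->
  (forall j, 0 <= t j) -> \sum_j t j = 1 ->
  (forall a, f a = \sum_j (t j)%:C *: T j a) ->
  rnorm (b - f b) <= delta -> rnorm (star b ** b - f (star b ** b)) <= delta ->
  t i * rnorm (b - T i b) ^+ 2 <= delta * (1 + 2 * rnorm b).
Proof.
move=> cpT t0 t1 fE Hb Hbb.
pose D j := b - T j b; pose bb := star b ** b.
pose Q j : A := (t j)%:C *: (star (D j) ** D j).
pose P j : A := (t j)%:C *: (T j bb - star (T j b) ** T j b).
pose E := f bb - star (f b) ** b - star b ** f b + bb.
have S1 : bb = \sum_j (t j)%:C *: bb.
  by rewrite -scaler_suml -rmorph_sum t1 scale1r.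
have S2 : star b ** f b = \sum_j (t j)%:C *: (star b ** T j b).
  by rewrite fE smul_sumr; apply: eq_bigr => j _; rewrite smulZr.
have S3 : star (f b) ** b = \sum_j (t j)%:C *: (star (T j b) ** b).
  by rewrite fE star_sum smul_suml; apply: eq_bigr => j _; rewrite starZr smulZl.
have EE : \sum_j (Q j + P j) = E.
  rewrite /E S2 S3 {2}S1 fE -!sumrB -big_split /=; apply: eq_bigr => j _.
  by rewrite /Q /P /D /bb !expandE; lmod; ring.
have Q0 j : nonneg (Q j) by apply: nonnegZ => //; exact: nonneg_square.
have P0 j : nonneg (P j).
  by apply: nonnegZ => //; apply: kadison_schwarz; case: (cpT j).
have QE : nonneg (E - Q i).
  rewrite -EE (bigD1 i) //=.
  have -> : Q i + P i + \sum_(j < n | j != i) (Q j + P j) - Q i =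
     P i + \sum_(j < n | j != i) (Q j + P j) by lmod; ring.
  apply: nonnegD => //; elim/big_ind: _ => [||j _]; [exact: nonneg0 | exact: nonnegD |].
  exact: nonnegD.
have := nonneg_rnorm_le (Q0 i) QE.
rewrite /Q rnormZ rnorm_cstar ger0_norm // => /le_trans; apply.
(* In this grouping each term contains one approximation defect, whence [delta (1 + 2 |b|)]. *)
have -> : E = star (b - f b) ** b + (star b ** (b - f b) - (bb - f bb)).
  by rewrite /E /bb !expandE; lmod; ring.
have b0 := rnorm_ge0 b.
apply: le_trans (rnormD _ _) _.
have H1 := rnormM (star (b - f b)) b; have H2 := rnormM (star b) (b - f b).
have H3 := rnormB (star b ** (b - f b)) (bb - f bb).
rewrite !rnorm_star in H1 H2.
have H4 : rnorm (b - f b) * rnorm b <= delta * rnorm b by exact: ler_wpM2r.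
rewrite /bb in H3 *; nra.
Qed.

Lemma large_coefficient (R : realType) n (t : 'I_n -> R) :
  \sum_j t j = 1 -> exists i, 1 <= n%:R * t i.
Proof.
move=> t1; apply: contrapT => H.
have lt_t i : n%:R * t i < 1 by rewrite ltNge; apply/negP => Hi; apply: H; exists i.
case: n t t1 {H} lt_t => [|n] t t1 lt_t.
  by move: t1; rewrite big_ord0 => /esym/eqP; rewrite oner_eq0.
have : \sum_(j < n.+1) (1 - n.+1%:R * t j) = 0.
  by rewrite sumrB -mulr_sumr t1 sumr_const card_ord mulr1 subrr.
move=> /psumr_eq0P => /(_ _ ord0 isT) H0.
have := lt_t ord0; rewrite -subr_gt0 H0 ?ltxx // => j _.
by rewrite subr_ge0 ltW.
Qed.

Lemma seq_rnorm_bound (R : realType) (A : cstarAlgType R) (s : seq A) :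
  exists2 M : R, 1 <= M & forall a, a \in s -> rnorm a <= M.
Proof.
elim: s => [|b s [M M1 HM]]; first by exists 1.
have b0 := rnorm_ge0 b; exists (M + rnorm b) => [|a]; first by lra.
rewrite inE => /predU1P[->|/HM]; lra.
Qed.

Theorem theorem14 (R : realType) (A : cstarAlgType R) :
  (exists n : nat,
    forall (S : set A) (eps : R), finite_set S -> 0 < eps ->
    exists (F : cstarAlgType R) (psi : {linear A -> F}) (phi : {linear F -> A}),
      [/\ finite_dimensional [set: F],
          completely_positive psi /\ contractive psi,
          completely_positive phi /\ contractive phi,
          (exists g : 'I_n -> {linear F -> A},
             (forall i, order_zero (g i) /\ contractive (g i)) /\
             convex_combination phi g)
        & forall a, S a -> rnorm (a - phi (psi a)) < eps]) ->
  AF A.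
Proof.
move=> [n Hn] S eps /finite_seqP[l Sl] eps0.
have [M M1 HM] := seq_rnorm_bound l; have M0 : 0 < M by lra.
(* The first bound gives [3 s <= 1/50], as Newton's iteration requires; the second gives
   [32 M s <= eps / 2]. *)
pose s := Num.min (1 / 200) (eps / (64 * M)).
have s0 : 0 < s by rewrite lt_min !divr_gt0 // mulr_gt0.
have s200 : s <= 1 / 200 by rewrite ge_min lexx.
have sM : s * (64 * M) <= eps.
  by rewrite -ler_pdivlMr ?mulr_gt0 // ge_min lexx orbT.
have s1 : s <= 1 by lra.
have th0 : 0 < s ^+ 4 by rewrite exprn_gt0.
clearbody s.
have s00 := ltW s0; have th00 := ltW th0; have M00 := ltW M0.
(* Adjoints are included because [k] must act almost as a unit on both sides. As [e] need not fix
   itself, a second unit [e2] is then chosen for it. *)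
have [d [e1 He]] := approx_unit (l ++ [seq star a | a <- l]) th0.
have [d2 [e21 He2]] := approx_unit [:: star d ** d] th0.
set e := star d ** d in e1 He He2; set e2 := star d2 ** d2 in e21 He2.
pose q := l ++ [:: e; e2].
have qM a : a \in q -> rnorm a <= M.
  rewrite mem_cat !inE => /orP[/HM //|/orP[/eqP->|/eqP->]]; lra.
(* Isolating a component bounds the square of its error, hence the outer square. Using [n.+1] keeps
   the denominator positive before [n] is known to be nonzero. *)
pose delta := (s ^+ 4) ^+ 2 / (n.+1%:R * (1 + 2 * M)).
have nM : 0 < n.+1%:R * (1 + 2 * M) by rewrite mulr_gt0 ?ltr0n //; lra.
have delta0 : 0 < delta by rewrite divr_gt0 // exprn_gt0.
have [] := Hn [set` q ++ [seq star a ** a | a <- q]] delta (finite_seq _) delta0.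
move=> F [psi [phi [fdF [cppsi ctpsi] _ [g [Hg [t [t0 t1 phiE]]]] approx]]].
have [u hu] := finite_dim_unit fdF.
have [i ti] := large_coefficient t1.
have [[cpg oz] ctg] := Hg i.
pose T j : {linear A -> A} := (g j \o psi : {linear A -> A}).
have cpT j : completely_positive (T j) /\ contractive (T j).
  have [[cpj _] ctj] := Hg j; split; first exact: cp_comp.
  by move=> a; apply: le_trans (ctj _) (ctpsi _).
have Tq a : a \in q -> rnorm (a - g i (psi a)) <= s ^+ 4.
  move=> aq.
  have h1 : rnorm (a - phi (psi a)) <= delta.
    by apply/ltW/approx; rewrite /= mem_cat aq.
  have h2 : rnorm (star a ** a - phi (psi (star a ** a))) <= delta.
    apply/ltW/approx; rewrite /= mem_cat; apply/orP; right.
    by apply/mapP; exists a.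
  have := @convex_component R A n t T (fun z => phi (psi z)) i a delta cpT t0 t1 _ h1 h2.
  move=> /(_ (fun z => phiE (psi z))) H.
  rewrite -ler_sqr ?nnegrE ?rnorm_ge0 //.
  have aM := qM a aq; have a0 := rnorm_ge0 a.
  have H1 : delta * (1 + 2 * rnorm a) <= delta * (1 + 2 * M).
    by apply: ler_wpM2l; [exact: ltW | lra].
  have H2 : n.+1%:R * (delta * (1 + 2 * M)) = (s ^+ 4) ^+ 2.
    by rewrite mulrCA /delta divfK // gt_eqF.
  set r := rnorm (a - g i (psi a)); have r0 : 0 <= r ^+ 2 by exact: sqr_ge0.
  have H3 : r ^+ 2 <= n%:R * (t i * r ^+ 2) by rewrite mulrA ler_peMl.
  have H4 : n%:R * (t i * r ^+ 2) <= n.+1%:R * (delta * (1 + 2 * M)).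
    apply: ler_pM => //; [exact: mulr_ge0 | by rewrite ler_nat | exact: le_trans H H1].
  by rewrite -H2; exact: le_trans H3 H4.
have eq : e \in q by rewrite mem_cat !inE eqxx orbT.
have e2q : e2 \in q by rewrite mem_cat !inE eqxx !orbT.
pose x := psi e; pose x2 := psi e2.
have pn c : nonneg (psi (star c ** c)).
  by have [c' ->] := cp_square c cppsi; exact: nonneg_square.
have x0 : nonneg x by exact: pn.
have x1 : rnorm x <= 1 by exact: le_trans (contractive_rnorm _ ctpsi) e1.
have x21 : rnorm x2 <= 1 by exact: le_trans (contractive_rnorm _ ctpsi) e21.
have [p [hp px qx]] := threshold_projection hu fdF x0 x1.
pose k := g i p.
have xe : rnorm (g i x - e) <= s ^+ 4 by rewrite rnorm_sub; exact: Tq.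
have x2e : rnorm (g i x2 - e2) <= s ^+ 4 by rewrite rnorm_sub; exact: Tq.
have ks := corner_sa cpg hp (erefl k); have k1 := corner_rnorm ctg hp (erefl k).
have ub := corner_unit_bound hu cpg ctg (erefl (g i u)) (ltW s0) s1
  (nonneg_sa (pn _)) x21 e1 xe x2e (He2 _ (mem_head _ _)).
(* The squared norm is at most [2 * 3 s^2], below [(3 s)^2]. *)
have ki : rnorm (k - k ** k) <= 3 * s.
  rewrite -ler_sqr ?nnegrE ?rnorm_ge0 ?mulr_ge0 //.
  apply: le_trans (corner_almost_idem fdF hu cpg ctg oz hp px (erefl (g i u)) (erefl k)) _.
  by have := sqr_ge0 s; nra.
have s50 : 3 * s <= 1 / 50 by lra.
have [G [Gs GG Gk Gc]] := almost_projection ks k1 ki s50.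
have near a : rnorm a <= M -> rnorm (a - e ** a) <= s ^+ 4 ->
    rnorm (a - k ** a) <= 2 * M * s ^+ 2.
  move=> aM ea; have a0 := rnorm_ge0 a.
  have Ms : 0 <= 2 * M * s ^+ 2 by rewrite !mulr_ge0 ?sqr_ge0.
  rewrite -ler_sqr ?nnegrE ?rnorm_ge0 //.
  apply: le_trans (corner_approx hu cpg ctg hp qx (erefl (g i u)) (erefl k) a) _.
  have H1 : rnorm (a - g i x ** a) <= 2 * M * s ^+ 4.
    have -> : a - g i x ** a = (a - e ** a) - (g i x - e) ** a.
      by rewrite !expandE; lmod; ring.
    apply: le_trans (rnormB _ _) _.
    have H2 : rnorm ((g i x - e) ** a) <= s ^+ 4 * M.
      by apply: le_trans (rnormM _ _) _; apply: ler_pM; rewrite ?rnorm_ge0.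
    have H3 : s ^+ 4 * 1 <= s ^+ 4 * M by rewrite ler_wpM2l.
    by move: ea H2 H3; rewrite mulr1; lra.
  have H4 : rnorm (star a ** (a - g i x ** a)) <= M * (2 * M * s ^+ 4).
    by apply: le_trans (rnormM _ _) _; rewrite rnorm_star; apply: ler_pM; rewrite ?rnorm_ge0.
  have -> : (2 * M * s ^+ 2) ^+ 2 = 2 * (M * (2 * M * s ^+ 4)) by ring.
  by rewrite ler_pM2l.
exists (corner_alg (g i) p G); split.
- exact: (corner_alg_sub fdF hu cpg ctg oz hp (erefl (g i u)) (erefl k)).
- exact: corner_alg_finite.
move=> a; rewrite Sl /= => al.
have aq : a \in q by rewrite mem_cat al.
have aM := HM a al.
have yM : rnorm (psi a) <= M by exact: le_trans (contractive_rnorm _ ctpsi) aM.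
have ka : rnorm (a - k ** a) <= 2 * M * s ^+ 2.
  by apply: near => //; apply: He; rewrite mem_cat al.
have ka' : rnorm (star a - k ** star a) <= 2 * M * s ^+ 2.
  apply: near; first by rewrite rnorm_star.
  by apply: He; rewrite mem_cat; apply/orP; right; apply/mapP; exists a.
have Gk' : rnorm (G - k ** k) <= 27 * s by move: Gk; lra.
have [b Bb ab] := corner_dist fdF hu cpg ctg oz hp (erefl (g i u)) (erefl k) (G := G)
  M1 (ltW s0) s1 aM yM (Tq a aq) ka ka' Gk'.
apply: le_lt_trans (_ : rnorm (a - b) < eps).
  apply: ge_inf; last by exists b.
  by exists 0 => _ [c _ <-]; exact: rnorm_ge0.
apply: le_lt_trans ab _; nra.
Qed.
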